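(* Let $N\ge 1$ be an integer. There exists $s_0\in(\frac12,1)$ such that for every $s\in(s_0,1)$ there is $\alpha=\alpha(s)\in(0,1)$ with the following property. Let $\Omega\subseteq\mathbb R^N$ be a domain (not necessarily bounded), let $f\in C(\Omega)$, and let $u:\mathbb R^N\to\mathbb R$ be a bounded viscosity solution of $\mathcal I u=f(x)$ in $\Omega$, where $\mathcal I$ is the operator of order $2s$ defined in the context. Then $u\in C^{0,\alpha}_{\mathrm{loc}}(\Omega)$. Moreover, given open sets $\omega\subset\subset\omega'\subset\subset\Omega$, one has $$\|u\|_{C^{0,\alpha}(\omega)}\le C,$$ where $C>0$ is a constant depending only on $s$, $\mathrm{dist}(\omega,\partial\omega')$, $\|u\|_{L^\infty(\mathbb R^N)}$ and $\|f\|_{L^\infty(\omega')}$.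
   Context: $\mathbb S^{N-1}$ is the unit sphere of $\mathbb R^N$; $B_r(x)$ is the ball of radius $r$ centered at $x$; $A\subset\subset B$ means that $\overline A$ is compact and contained in $B$. For $u:\mathbb R^N\to\mathbb R$ put $\delta(u,x,y)=u(x+y)+u(x-y)-2u(x)$. For $s\in(0,1)$ and $\xi\in\mathbb S^{N-1}$, $$\mathcal I_\xi u(x)=C_s\int_0^{+\infty}\frac{\delta(u,x,\tau\xi)}{\tau^{1+2s}}\,d\tau,\qquad \mathcal I u(x)=\inf_{\xi\in\mathbb S^{N-1}}\mathcal I_\xi u(x)+\sup_{\xi\in\mathbb S^{N-1}}\mathcal I_\xi u(x),$$ where $C_s>0$ is a normalizing constant depending only on $s$ such that $\lim_{s\to1^-}\mathcal I_\xi u(x)=\langle D^2u(x)\xi,\xi\rangle$ for bounded smooth $u$. Viscosity solutions (standard definition): let $u:\mathbb R^N\to\mathbb R$ be bounded, Borel measurable and continuous in $\Omega$. $u$ is a viscosity subsolution (resp. supersolution) of $\mathcal Iu=f$ in $\Omega$ if for every $x_0\in\Omega$, every $\rho>0$ with $\overline{B_\rho(x_0)}\subset\Omega$ and every $\varphi\in C^2(\overline{B_\rho(x_0)})$ with $\varphi(x_0)=u(x_0)$ and $u\le\varphi$ (resp. $u\ge\varphi$) in $B_\rho(x_0)$, the function $\psi$ equal to $\varphi$ in $\overline{B_\rho(x_0)}$ and to $u$ elsewhere satisfies $\mathcal I\psi(x_0)\ge f(x_0)$ (resp. $\mathcal I\psi(x_0)\le f(x_0)$). A viscosity solution is a function that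 is both a subsolution and a supersolution. $\|u\|_{L^\infty(\mathbb R^N)}$ denotes $\sup_{\mathbb R^N}|u|$, and $\|u\|_{C^{0,\alpha}(\omega)}=\sup_\omega|u|+\sup_{x\ne y\in\omega}\frac{|u(x)-u(y)|}{|x-y|^\alpha}$. *)

(* Defs.v *)
From HB Require Import structures.
From mathcomp Require Export all_boot all_order all_algebra.
From mathcomp Require Export all_classical all_reals all_analysis.

Set Implicit Arguments.
Unset Strict Implicit.
Unset Printing Implicit Defensive.

Export Order.TTheory GRing.Theory Num.Theory.
Export numFieldNormedType.Exports.


Local Open Scope classical_set_scope.
Local Open Scope ring_scope.

Section Euclidean.
Context {R : realType} {N : nat}.
Implicit Types (x y : 'rV[R]_N) (A B : set 'rV[R]_N).

(* The library norm `|x| on 'rV[R]_N is the max norm (it induces the same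
   topology), so the Euclidean norm, balls and distances are defined here. *)
Definition enorm x : R := Num.sqrt (\sum_(i < N) x ord0 i ^+ 2).

Definition eball x (r : R) : set 'rV[R]_N := [set y | enorm (y - x) < r].

Definition esphere : set 'rV[R]_N := [set xi | enorm xi = 1].

(* Extended-real valued: +oo when one of the sets is empty. *)
Definition edist A B : \bar R :=
  ereal_inf [set z | exists x y, [/\ A x, B y & z = (enorm (x - y))%:E]].

Definition boundary A : set 'rV[R]_N := closure A `\` interior A.

Definition domain A : Prop := [/\ A !=set0, open A & connected A].

Definition compactly_in A B : Prop :=
  compact (closure A) /\ closure A `<=` B.

Definition borel_fun (u : 'rV[R]_N -> R) : Prop :=
  @measurable_fun _ _ (g_sigma_algebraType (@open 'rV[R]_N)) R setT u.

End Euclidean.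

Section Norms.
Context {R : realType} {N : nat}.
Implicit Types (A : set 'rV[R]_N) (u : 'rV[R]_N -> R).

(* In the two suprema below, the maximum with 0 only matters when there is no
   x (resp. no pair x != y) in A: ereal_sup set0 is -oo. *)
Definition sup_norm A u : \bar R :=
  maxe 0%E (ereal_sup [set z | exists2 x, A x & z = (`|u x|)%:E]).

Definition holder_seminorm (alpha : R) A u : \bar R :=
  maxe 0%E (ereal_sup [set z | exists x y, [/\ A x, A y, x <> y &
    z = (`|u x - u y| / enorm (x - y) `^ alpha)%:E]]).

Definition holder_norm (alpha : R) A u : \bar R :=
  (sup_norm A u + holder_seminorm alpha A u)%E.

Definition holder_loc (alpha : R) A u : Prop :=
  forall w : set 'rV[R]_N, open w -> compactly_in w A ->
    (holder_norm alpha w u < +oo)%E.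

End Norms.

Section Smoothness.
Context {R : realType} {N : nat}.
Implicit Types (U : set 'rV[R]_N) (u : 'rV[R]_N -> R).

Definition evec (i : 'I_N) : 'rV[R]_N := delta_mx ord0 i.

(* C^n(closure U) for U open: all partial derivatives of order at most n exist
   in U and extend continuously to closure U (g is the extension of the i-th
   partial derivative of u). *)
Fixpoint Cn_closure (n : nat) U u : Prop :=
  {within closure U, continuous u} /\
  match n with
  | 0 => True
  | m.+1 => forall i : 'I_N, exists2 g : 'rV[R]_N -> R,
      Cn_closure m U g & forall x, U x -> is_derive x (evec i) u (g x)
  end.

Definition smooth u : Prop := forall n, Cn_closure n setT u.

Definition hessian u (x : 'rV[R]_N) : 'M[R]_N :=
  \matrix_(i < N, j < N) 'D_(evec j) (fun y => 'D_(evec i) u y) x.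

(* <D^2 u(x) xi, xi> *)
Definition hessian_form u (x xi : 'rV[R]_N) : R :=
  (xi *m hessian u x *m xi^T) ord0 ord0.

End Smoothness.

Section Operator.
Context {R : realType} {N : nat}.
Implicit Types (u : 'rV[R]_N -> R) (x y xi : 'rV[R]_N) (s : R).

Definition delta2 u x y : R := u (x + y) + u (x - y) - 2 * u x.

Variable Cs : R -> R.

Definition I_dir s xi u x : \bar R :=
  ((Cs s)%:E * \int[lebesgue_measure]_(t in `]0%R, +oo[)
                  (delta2 u x (t *: xi) / t `^ (1 + 2 * s))%:E)%E.

Definition I_op s u x : \bar R :=
  (ereal_inf [set I_dir s xi u x | xi in esphere]
   + ereal_sup [set I_dir s xi u x | xi in esphere])%E.

Definition normalizing : Prop :=
  (forall s, 0 < s < 1 -> 0 < Cs s) /\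
  (forall u, smooth u -> bounded_fun u ->
    forall x xi, esphere xi ->
      I_dir s xi u x @[s --> 1^'-] --> (hessian_form u x xi)%:E).

Definition visc_class (Omega : set 'rV[R]_N) u : Prop :=
  [/\ bounded_fun u, borel_fun u & {within Omega, continuous u}].

(* patch u A phi is phi on A and u elsewhere. *)
Definition visc_sub s (Omega : set 'rV[R]_N) (f : 'rV[R]_N -> R) u : Prop :=
  visc_class Omega u /\
  forall x0 (rho : R) (phi : 'rV[R]_N -> R),
    Omega x0 -> 0 < rho -> closure (eball x0 rho) `<=` Omega ->
    Cn_closure 2 (eball x0 rho) phi -> phi x0 = u x0 ->
    (forall x, eball x0 rho x -> u x <= phi x) ->
    ((f x0)%:E <= I_op s (patch u (closure (eball x0 rho)) phi) x0)%E.

Definition visc_super s (Omega : set 'rV[R]_N) (f : 'rV[R]_N -> R) u : Prop :=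
  visc_class Omega u /\
  forall x0 (rho : R) (phi : 'rV[R]_N -> R),
    Omega x0 -> 0 < rho -> closure (eball x0 rho) `<=` Omega ->
    Cn_closure 2 (eball x0 rho) phi -> phi x0 = u x0 ->
    (forall x, eball x0 rho x -> phi x <= u x) ->
    (I_op s (patch u (closure (eball x0 rho)) phi) x0 <= (f x0)%:E)%E.

Definition visc_sol s (Omega : set 'rV[R]_N) (f : 'rV[R]_N -> R) u : Prop :=
  visc_sub s Omega f u /\ visc_super s Omega f u.

End Operator.

Arguments normalizing {R} N Cs.

(* Main.v *)
Require Import Defs.
From mathcomp Require Import ring lra measurable_realfun.
Set Implicit Arguments.
Unset Strict Implicit.
Unset Printing Implicit Defensive.
Local Open Scope classical_set_scope.
Local Open Scope ring_scope.

(** Ishii-Lions doubling of variables, with exponent 1/4 and s close to 1.  Let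
(x, y) be a positive maximum point of u(x) - u(y) - L|x - y|^(1/4) - m|x - x0|^2,
a = |x - y| and e = (x - y)/a.  By concavity of t |-> t^(1/8), u is touched at x
from above and at y from below by paraboloids.  Subtracting the two viscosity
inequalities bounds f(x) - f(y) by
  (I_e(x) - I_e(y)) + (sup_xi I_xi(x) - inf_eta I_eta(y)).
In the first bracket, moving x and y in opposite directions along e gains
-3/4 L a^(1/4) (t/a)^2 for t <= a/2.  In the second one, xi and eta may be taken
at an acute angle, so that |xi - eta|^2 <= 2 and the loss is at most
1/2 L a^(1/4) (t/a)^2.  The net gain, integrated against t^(-1-2s), carries the
factor 1/(1 - s) and beats the contribution of t > a/2, which stays bounded as
s -> 1.  So L is bounded in terms of f, sup|u| and the distance to the boundary. *)

(** * Euclidean geometry *)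

(** The pair (xi, eta) of the second bracket is uncontrolled, and this dictates the exponent. For a
    power |w|^g of w = x - y, moving the two points oppositely along e displaces w by 2 t e and
    gains 4 g (1 - g) |w|^g (t/a)^2 to second order, while (xi, eta) may lose g |xi - eta|^2 |w|^g
    (t/a)^2. If |xi - eta|^2 could reach 4, the loss would exceed the gain for every g in (0, 1);
    with the bound 2, obtained from the evenness of I_eta in eta, the gain wins exactly when g <
    1/2. The choice g = 1/4 makes the power two nested square roots, so that every concavity
    estimate reduces to comparing squares.

    The other obstacle is that u is continuous only in Omega, whereas maximality is needed against
    all displacements. The penalty m|x - x0|^2 and the size of L confine every positive value of the
    doubled function to a compact set of pairs over Omega, so a maximum over that set is a maximum
    over the whole space. *)

Section EuclideanGeometry.
Context {R : realType} {N : nat}.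
Implicit Types (x y z v w : 'rV[R]_N) (a b t r : R).

Definition edot x y : R := \sum_(i < N) x ord0 i * y ord0 i.

Lemma edotC x y : edot x y = edot y x.
Proof. by apply: eq_bigr => i _; rewrite mulrC. Qed.

Lemma edotDl x y z : edot (x + y) z = edot x z + edot y z.
Proof. by rewrite -big_split; apply: eq_bigr => i _; rewrite mxE mulrDl. Qed.

Lemma edotZl a x y : edot (a *: x) y = a * edot x y.
Proof. by rewrite mulr_sumr; apply: eq_bigr => i _; rewrite mxE mulrA. Qed.

Lemma edotNl x y : edot (- x) y = - edot x y.
Proof. by rewrite -scaleN1r edotZl mulN1r. Qed.

Lemma edotBl x y z : edot (x - y) z = edot x z - edot y z.
Proof. by rewrite edotDl edotNl. Qed.

Lemma edotDr x y z : edot x (y + z) = edot x y + edot x z.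
Proof. by rewrite edotC edotDl !(edotC x). Qed.

Lemma edotZr a x y : edot x (a *: y) = a * edot x y.
Proof. by rewrite edotC edotZl edotC. Qed.

Lemma edotNr x y : edot x (- y) = - edot x y.
Proof. by rewrite edotC edotNl edotC. Qed.

Lemma edotBr x y z : edot x (y - z) = edot x y - edot x z.
Proof. by rewrite edotDr edotNr. Qed.

Definition edotE :=
  (edotDl, edotDr, edotBl, edotBr, edotNl, edotNr, edotZl, edotZr).

Lemma edot_parallelogram x y :
  edot (x + y) (x + y) + edot (x - y) (x - y) = 2 * edot x x + 2 * edot y y.
Proof. by rewrite !edotE (edotC y x); ring. Qed.

Lemma edot_ge0 x : 0 <= edot x x.
Proof. by apply: sumr_ge0 => i _; rewrite -expr2 sqr_ge0. Qed.

Lemma enorm_ge0 x : 0 <= enorm x.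
Proof. exact: sqrtr_ge0. Qed.

Lemma sqr_enorm x : enorm x ^+ 2 = edot x x.
Proof.
by rewrite sqr_sqrtr; [apply: eq_bigr => i _; rewrite expr2
                      |apply: sumr_ge0 => i _; exact: sqr_ge0].
Qed.

Lemma enormE x : enorm x = Num.sqrt (edot x x).
Proof. by rewrite -sqr_enorm sqrtr_sqr ger0_norm ?enorm_ge0. Qed.

Lemma enormZ a x : enorm (a *: x) = `|a| * enorm x.
Proof.
rewrite !enormE !edotE mulrA -expr2 sqrtrM ?sqr_ge0//.
by rewrite sqrtr_sqr.
Qed.

Lemma enormN x : enorm (- x) = enorm x.
Proof. by rewrite !enormE !edotE opprK. Qed.

Lemma enorm_distC x y : enorm (x - y) = enorm (y - x).
Proof. by rewrite -opprB enormN. Qed.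

Lemma enorm0 : enorm (0 : 'rV[R]_N) = 0.
Proof. by rewrite enormE -(scale0r 0) edotZl mul0r sqrtr0. Qed.

Lemma enorm_eq0 x : enorm x = 0 -> x = 0.
Proof.
move=> x0; have : edot x x = 0 by rewrite -sqr_enorm x0 expr0n.
rewrite /edot => /eqP; rewrite psumr_eq0; last first.
  by move=> i _; rewrite -expr2 sqr_ge0.
move=> /allP h; apply/rowP => i; rewrite mxE; apply/eqP.
by have := h i (mem_index_enum i); rewrite mulf_eq0 orbb.
Qed.

(** Cauchy-Schwarz, by expanding the squared norm of |y| x - |x| y and cancelling the factor 2 |x|
    |y|; null vectors are set aside for this cancellation. *)
Lemma edot_le x y : edot x y <= enorm x * enorm y.
Proof.
have [x0|x0] := eqVneq (enorm x) 0.
  by rewrite (enorm_eq0 x0) -(scale0r 0) edotZl mul0r enormZ normr0 !mul0r.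
have [y0|y0] := eqVneq (enorm y) 0.
  by rewrite (enorm_eq0 y0) -(scale0r 0) edotZr mul0r enormZ normr0 mul0r mulr0.
have xp : 0 < enorm x by rewrite lt_neqAle eq_sym x0 enorm_ge0.
have yp : 0 < enorm y by rewrite lt_neqAle eq_sym y0 enorm_ge0.
have := edot_ge0 (enorm y *: x - enorm x *: y).
rewrite !edotE -!sqr_enorm (edotC y x) => h.
have {}h : 0 <= 2 * (enorm x * enorm y) * (enorm x * enorm y - edot x y).
  by apply: le_trans h _; rewrite le_eqVlt; apply/orP; left; apply/eqP; ring.
by move: h; rewrite pmulr_rge0 ?subr_ge0// mulr_gt0// mulr_gt0.
Qed.

Lemma enormD_le x y : enorm (x + y) <= enorm x + enorm y.
Proof.
rewrite -(ler_pXn2r (ltn0Sn 1)) ?nnegrE ?addr_ge0 ?enorm_ge0//.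
rewrite sqr_enorm !edotE (edotC y x) -!sqr_enorm sqrrD.
by have := edot_le x y; lra.
Qed.

Lemma enormB_le x y z : enorm (x - z) <= enorm (x - y) + enorm (y - z).
Proof. by rewrite (le_trans _ (enormD_le _ _))// addrA subrK. Qed.

Lemma sum_continuous (T : topologicalType) (f : 'I_N -> T -> R) :
  (forall i, continuous (f i)) -> continuous (fun p : T => \sum_(i < N) f i p).
Proof.
move=> cf x; apply: (@cvg_big _ _ +%R 0 xpredT _ T (nbhs x) _ f (f ^~ x)).
  exact: (@pseudometric_normed_Zmodule.add_continuous _ R^o).
by move=> i _; exact: cf.
Qed.

Lemma edotxx_continuous : continuous (fun x => edot x x).
Proof.
apply: sum_continuous => i x; apply: (@cvgM _ _ (nbhs x)); exact: coord_continuous.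
Qed.

Lemma enorm_continuous : continuous (@enorm R N).
Proof.
have -> : @enorm R N = Num.sqrt \o (fun x => edot x x).
  by apply/funext => x; rewrite enormE.
move=> x; apply: continuous_comp; first exact: edotxx_continuous.
exact: sqrt_continuous.
Qed.

Lemma norm_le_enorm x : `|x| <= enorm x.
Proof.
rewrite /Num.norm/= mx_normrE; apply/bigmax_leP => /=; split.
  exact: enorm_ge0.
case=> i j _ /=; rewrite ord1.
rewrite -(ler_pXn2r (ltn0Sn 1)) ?nnegrE ?enorm_ge0// sqr_enorm /edot.
rewrite (bigD1 j)//= real_normK ?num_real// expr2 lerDl sumr_ge0// => k _.
by rewrite -expr2 sqr_ge0.
Qed.

Lemma enormB_continuous x : continuous (fun y => enorm (y - x)).
Proof.
move=> y; apply: (@continuous_comp _ _ _ (fun y => y - x) (@enorm R N)).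
  by apply: (@cvgB _ _ _ (nbhs y)); [exact: cvg_id|exact: cvg_cst].
exact: enorm_continuous.
Qed.

Lemma closed_le_enorm x r : closed [set y | enorm (y - x) <= r].
Proof.
have /continuous_closedP := @enormB_continuous x.
by move=> /(_ _ (@closed_le _ r)).
Qed.

Lemma compact_le_enorm x r : compact [set y | enorm (y - x) <= r].
Proof.
apply: bounded_closed_compact; last exact: closed_le_enorm.
exists (`|x| + r); split; first exact: num_real.
move=> t rt y /= yr; rewrite -(subrK x y) (le_trans (ler_normD _ _))//.
by rewrite addrC (le_trans _ (ltW rt))// lerD2l (le_trans (norm_le_enorm _)).
Qed.

Lemma closure_eball x r : 0 < r ->
  closure (eball x r) = [set y | enorm (y - x) <= r].
Proof.
move=> r0; apply/seteqP; split.
  rewrite [X in _ `<=` X](iffLR (closure_id _) (@closed_le_enorm x r)).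
  by apply: closure_subset => y /= /ltW.
move=> y /= yr B /= By.
(* Sliding [y] towards the centre multiplies its distance to [x] by 1 - t, so [y] is a limit of
   points of the open ball. *)
have : ((1 - t) *: y + t *: x) @[t --> 0^'+] --> (1 - 0) *: y + 0 *: x.
  apply: cvg_at_right_filter.
  apply: (@cvgD _ _ _ (nbhs (0 : R))); apply: (@cvgZ _ _ _ (nbhs (0 : R))).
  - by apply: (@cvgB _ _ _ (nbhs (0 : R))); [exact: cvg_cst|exact: cvg_id].
  - exact: cvg_cst.
  - exact: cvg_id.
  - exact: cvg_cst.
rewrite subr0 scale1r scale0r addr0 => /(_ _ By) h.
near (0 : R)^'+ => t.
exists ((1 - t) *: y + t *: x); split; last by near: t; exact: h.
rewrite /eball/=.
have -> : (1 - t) *: y + t *: x - x = (1 - t) *: (y - x).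
  by apply/rowP => i; rewrite !mxE; ring.
have t0 : 0 < t by near: t; exact: nbhs_right_gt.
have t1 : t < 1 by near: t; exact: nbhs_right_lt.
rewrite enormZ ger0_norm; last by rewrite subr_ge0 ltW.
have [->|/eqP y0] := eqVneq (enorm (y - x)) 0; first by rewrite mulr0.
have : 0 < enorm (y - x) by rewrite lt_neqAle enorm_ge0 eq_sym; move/eqP: y0 => ->.
nra.
Unshelve. all: by end_near.
Qed.

Lemma open_eball_subset (A : set 'rV[R]_N) x : open A -> A x ->
  exists2 r, 0 < r & [set y | enorm (y - x) <= r] `<=` A.
Proof.
move=> oA Ax; have /nbhs_ballP[e /= e0 eA] := open_nbhs_nbhs (conj oA Ax).
exists (e / 2); first by rewrite divr_gt0.
move=> y /= ye; apply: eA; rewrite -ball_normE /= distrC.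
by rewrite (le_lt_trans (norm_le_enorm _))// (le_lt_trans ye)// ltr_pdivrMr// ltr_pMr// ltr1n.
Qed.

Lemma open_eball x r : open (eball x r).
Proof.
have /continuousP := @enormB_continuous x.
by move=> /(_ _ (@open_lt _ r)).
Qed.

End EuclideanGeometry.

(** * Paraboloids *)

Section Paraboloids.
Context {R : realType} {N : nat}.
Implicit Types (x y p q v : 'rV[R]_N) (a b c d : R) (U : set 'rV[R]_N).

(** On the line the difference quotient is exactly d + h c. This yields both the first and the
    second partial derivatives in [paraboloid_C2]. *)
Lemma is_derive_quadratic_line (f : 'rV[R]_N -> R) x v d c :
  (forall h : R, f (h *: v + x) = f x + h * d + h ^+ 2 * c) ->
  is_derive x v f d.
Proof.
move=> fE.
have cf : h^-1 *: (f (h *: v + x) - f x) @[h --> 0^'] --> d.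
  have : d + h * c @[h --> (0 : R)^'] --> d + 0 * c.
    apply: cvg_within_filter; apply: (@cvgD _ _ _ (nbhs (0 : R))).
      exact: cvg_cst.
    by apply: (@cvgM _ _ (nbhs (0 : R))); [exact: cvg_id|exact: cvg_cst].
  rewrite mul0r addr0; apply: cvg_trans.
  apply: near_eq_cvg; near=> h.
  have h0 : h != 0 by near: h; exact: nbhs_dnbhs_neq.
  by rewrite fE /GRing.scale/=; field.
apply: DeriveDef; first by apply/cvg_ex; exists d.
exact: cvg_lim cf.
Unshelve. all: by end_near.
Qed.

(** Two centres are needed: the test function from above carries a tangent paraboloid centred at the
    other maximum point and the penalty centred at x0. *)
Definition paraboloid c a p b q x : R :=
  c + a * edot (x - p) (x - p) + b * edot (x - q) (x - q).

Lemma edotB_continuous p : continuous (fun x => edot (x - p) (x - p)).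
Proof.
move=> y.
have := @continuous_comp _ _ _ (fun y => y - p)
  (fun z : 'rV[R]_N => edot z z) y; apply.
  by apply: (@cvgB _ _ _ (nbhs y)); [exact: cvg_id|exact: cvg_cst].
exact: edotxx_continuous.
Qed.

Lemma paraboloid_continuous c a p b q : continuous (paraboloid c a p b q).
Proof.
move=> x; apply: (@cvgD _ _ _ (nbhs x)).
  apply: (@cvgD _ _ _ (nbhs x)); first exact: cvg_cst.
  apply: (@cvgM _ _ (nbhs x)); first exact: cvg_cst.
  exact: edotB_continuous.
apply: (@cvgM _ _ (nbhs x)); first exact: cvg_cst.
exact: edotB_continuous.
Qed.

Lemma edot_evec x i : edot x (evec i) = x ord0 i.
Proof.
rewrite /edot (bigD1 i)//= big1 ?addr0; last first.
  by move=> j /negbTE ji; rewrite mxE eqxx ji mulr0.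
by rewrite mxE !eqxx mulr1.
Qed.

Lemma paraboloid_C2 c a p b q U : Cn_closure 2 U (paraboloid c a p b q).
Proof.
split; first exact/continuous_subspaceT/paraboloid_continuous.
move=> i; exists (fun x => 2 * a * (x - p) ord0 i + 2 * b * (x - q) ord0 i).
  split.
    apply: continuous_subspaceT => x; apply: (@cvgD _ _ _ (nbhs x));
      (apply: (@cvgM _ _ (nbhs x)); first exact: cvg_cst);
      (apply: (@continuous_comp _ _ _ (fun y => y - _)
        (fun z : 'rV[R]_N => z ord0 i)); last exact: coord_continuous);
      by apply: (@cvgB _ _ _ (nbhs x)); [exact: cvg_id|exact: cvg_cst].
  move=> j; exists (fun=> 2 * (a + b) * (evec j : 'rV[R]_N) ord0 i).
    by split => //; apply: continuous_subspaceT => x; exact: (@cvg_cst _ _ _ (nbhs x)).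
  move=> x _; apply: (@is_derive_quadratic_line _ _ _ _ 0) => h.
  by rewrite !mxE; ring.
move=> x _; apply: (@is_derive_quadratic_line _ _ _ _
  ((a + b) * edot (evec i) (evec i : 'rV[R]_N))) => h.
rewrite -!edot_evec /paraboloid.
rewrite -!(addrA (h *: _)) !(edotDl (h *: _)) !(edotDr _ (h *: _)).
by rewrite !(edotZl, edotZr) !(edotC (evec i) (_ - _)); ring.
Qed.

Lemma delta2_paraboloid c a p b q x v :
  delta2 (paraboloid c a p b q) x v = 2 * (a + b) * edot v v.
Proof.
rewrite /delta2 /paraboloid.
rewrite -!(addrAC _ _ v) -!(addrAC _ _ (- v)) !(edotBl _ v, edotDl _ v).
rewrite !(edotBr _ _ v, edotDr _ _ v) !(edotC v (_ - _)); ring.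
Qed.

End Paraboloids.

(** * The fourth root of the norm *)

Section FourthRoot.
Context {R : realType}.
Implicit Types (t z : R).

Lemma powR4_sqrt t : 0 <= t -> t `^ 4^-1 = Num.sqrt (Num.sqrt t).
Proof.
move=> t0; rewrite -!powR12_sqrt ?sqrtr_ge0 ?powR_ge0// -powRrM; congr powR.
by field.
Qed.

Lemma sqrt_le_tangent t : 0 <= t -> Num.sqrt t <= 1 + (t - 1) / 2.
Proof.
move=> t0; have := sqr_ge0 (Num.sqrt t - 1).
by rewrite sqrrB sqr_sqrtr// expr1n mulr1; lra.
Qed.

Lemma powR4_le_tangent t : 0 <= t -> t `^ 4^-1 <= 1 + (t - 1) / 4.
Proof.
move=> t0; rewrite powR4_sqrt//.
by have := sqrt_le_tangent (sqrtr_ge0 t); have := sqrt_le_tangent t0; lra.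
Qed.

(** The tangent is taken in the variable t^2 so that, when t is a Euclidean norm, the bound is a
    quadratic polynomial and can serve as a C^2 test function; a bound affine in t would have a kink
    at the origin. *)
Lemma powR4_le_tangent_sqr t : 0 <= t -> t `^ 4^-1 <= 1 + (t ^+ 2 - 1) / 8.
Proof.
move=> t0; have := powR4_le_tangent t0; have := sqr_ge0 (t - 1).
by rewrite sqrrB expr1n mulr1; lra.
Qed.

Lemma sqrt_le_sqr t z : 0 <= z -> t <= z ^+ 2 -> Num.sqrt t <= z.
Proof.
by move=> z0 tz; rewrite (le_trans (ler_wsqrtr tz))// sqrtr_sqr ger0_norm.
Qed.

Lemma le_of_sqr_le t z : 0 <= z -> t ^+ 2 <= z ^+ 2 -> t <= z.
Proof.
move=> z0 tz; rewrite (le_trans (ler_norm t))// -sqrtr_sqr.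
exact: sqrt_le_sqr.
Qed.

(** Squaring removes one level of roots at a time: (p + q)^2 = 2 + 2 p q bounds the sum of square
    roots, then (P + Q)^2 = p + q + 2 P Q the sum of fourth roots. Since -3/16 is the second
    derivative of t^(1/4) at 1, nothing is lost to second order. *)
Lemma powR4_second_difference z : 0 <= z <= 1 ->
  (1 + z) `^ 4^-1 + (1 - z) `^ 4^-1 <= 2 - 3 / 16 * z ^+ 2.
Proof.
move=> /andP[z0 z1]; rewrite !powR4_sqrt; [|lra|lra].
set p := Num.sqrt (1 + z); set q := Num.sqrt (1 - z).
have p0 : 0 <= p by exact: sqrtr_ge0.
have q0 : 0 <= q by exact: sqrtr_ge0.
have p2 : p ^+ 2 = 1 + z by rewrite sqr_sqrtr; lra.
have q2 : q ^+ 2 = 1 - z by rewrite sqr_sqrtr; lra.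
have z2 : 0 <= z ^+ 2 <= 1 by rewrite sqr_ge0 expr_le1.
move: z2 => /andP[z20 z21].
have pq : p * q <= 1 - z ^+ 2 / 2.
  apply: le_of_sqr_le; first lra.
  rewrite exprMn p2 q2; nra.
have pDq : p + q <= 2 - z ^+ 2 / 4.
  apply: le_of_sqr_le; first lra.
  rewrite sqrrD p2 q2; nra.
set P := Num.sqrt p; set Q := Num.sqrt q.
have P0 : 0 <= P by exact: sqrtr_ge0.
have Q0 : 0 <= Q by exact: sqrtr_ge0.
have P2 : P ^+ 2 = p by rewrite sqr_sqrtr.
have Q2 : Q ^+ 2 = q by rewrite sqr_sqrtr.
have PQ : P * Q <= 1 - z ^+ 2 / 4.
  apply: le_of_sqr_le; first lra.
  rewrite exprMn P2 Q2; nra.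
apply: le_of_sqr_le; first lra.
rewrite sqrrD P2 Q2; nra.
Qed.

End FourthRoot.

Section FourthRootNorm.
Context {R : realType} {N : nat}.
Implicit Types (v w z : 'rV[R]_N) (t : R).

Local Notation root4 v := (enorm v `^ 4^-1).

Lemma root4_scale w v : 0 < enorm w ->
  root4 v = root4 w * (enorm v / enorm w) `^ 4^-1.
Proof.
move=> w0; rewrite -powRM ?divr_ge0 ?enorm_ge0//.
by rewrite mulrC divfK// gt_eqF.
Qed.

Lemma root4_le_paraboloid w v : 0 < enorm w ->
  root4 v <= root4 w + root4 w / (8 * enorm w ^+ 2) * (edot v v - edot w w).
Proof.
move=> w0; rewrite (root4_scale _ w0).
have n0 : 0 <= enorm v / enorm w by rewrite divr_ge0 ?enorm_ge0.
have := ler_wpM2l (powR_ge0 (enorm w) 4^-1) (powR4_le_tangent_sqr n0).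
move=> /le_trans; apply; rewrite -!sqr_enorm le_eqVlt; apply/orP; left.
by apply/eqP; field; rewrite gt_eqF.
Qed.

Lemma root4_le_cone w v : 0 < enorm w ->
  root4 v <= root4 w * (1 + (enorm v / enorm w - 1) / 4).
Proof.
move=> w0; rewrite (root4_scale _ w0).
by rewrite ler_wpM2l ?powR_ge0// powR4_le_tangent// divr_ge0 ?enorm_ge0.
Qed.

Lemma root4Z t w : root4 (t *: w) = `|t| `^ 4^-1 * root4 w.
Proof. by rewrite enormZ powRM ?enorm_ge0. Qed.

(** For t <= 1/2 the point [w - (2 * t) *: w] has not crossed the origin, where the root has a cusp.
    Past it concavity is lost, and [root4_radial_linear] only records linear growth. *)
Lemma root4_radial_concave w t : 0 <= t <= 2^-1 ->
  root4 (w + (2 * t) *: w) + root4 (w - (2 * t) *: w) - 2 * root4 w <=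
  - (3 / 4 * t ^+ 2) * root4 w.
Proof.
move=> /andP[t0 t2].
rewrite -{1 3}(scale1r w) -scalerDl -scalerBl !root4Z !ger0_norm; [|lra|lra].
have /powR4_second_difference : 0 <= 2 * t <= 1 by apply/andP; split; lra.
by have := powR_ge0 (enorm w) 4^-1; nra.
Qed.

Lemma root4_radial_linear w t : 2^-1 <= t ->
  root4 (w + (2 * t) *: w) + root4 (w - (2 * t) *: w) - 2 * root4 w <=
  t * root4 w.
Proof.
move=> t2.
rewrite -{1 3}(scale1r w) -scalerDl -scalerBl !root4Z ger0_norm; last lra.
rewrite ler0_norm; last lra.
have t1 : 0 <= 1 + 2 * t by lra.
have t3 : 0 <= - (1 - 2 * t) by lra.
have := powR4_le_tangent t1; have := powR4_le_tangent t3.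
by have := powR_ge0 (enorm w) 4^-1; nra.
Qed.

(** Two instances of the tangent paraboloid at [w] are added, and the terms linear in [z] cancel.
    The constant 1/2 is 2/8 times the bound 2 on |z|^2; it has to stay below the 3/4 of
    [root4_radial_concave]. *)
Lemma root4_transversal_quadratic w z t : 0 < enorm w -> edot z z <= 2 ->
  root4 (w + (t * enorm w) *: z) + root4 (w - (t * enorm w) *: z) - 2 * root4 w
  <= t ^+ 2 / 2 * root4 w.
Proof.
move=> w0 z2.
have := root4_le_paraboloid (w + (t * enorm w) *: z) w0.
have := root4_le_paraboloid (w - (t * enorm w) *: z) w0.
rewrite !(edotBl w, edotDl w) !(edotBr _ w, edotDr _ w).
rewrite !(edotNl, edotNr, edotZl, edotZr) (edotC z w).
set r := root4 w; set d := edot w z; set k := r / _ => h1 h2.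
have k0 : 0 <= k by rewrite divr_ge0 ?powR_ge0// mulr_ge0// sqr_ge0.
have kw : k * enorm w ^+ 2 = r / 8 by rewrite /k; field; rewrite gt_eqF.
have t20 := sqr_ge0 t.
have : 2 * (k * enorm w ^+ 2) * t ^+ 2 * edot z z <= t ^+ 2 / 2 * r.
  rewrite kw; have r0 : 0 <= r by exact: powR_ge0.
  have : t ^+ 2 * r * edot z z <= t ^+ 2 * r * 2.
    by rewrite ler_wpM2l// mulr_ge0.
  lra.
lra.
Qed.

Lemma root4_transversal_linear w z t : 0 < enorm w -> edot z z <= 2 ->
  0 <= t ->
  root4 (w + (t * enorm w) *: z) + root4 (w - (t * enorm w) *: z) - 2 * root4 w
  <= t * root4 w.
Proof.
move=> w0 z2 t0.
have z1 : enorm z <= 2 by rewrite enormE sqrt_le_sqr//; lra.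
have bnd v : enorm v <= enorm w + t * enorm w * 2 ->
    root4 v <= root4 w * (1 + t / 2).
  move=> vw; apply: (le_trans (root4_le_cone v w0)).
  rewrite ler_wpM2l ?powR_ge0// lerD2l.
  rewrite -[t / 2](_ : ((1 + t * 2) - 1) / 4 = _); last by field.
  rewrite ler_pM2r// lerD2r ler_pdivrMr// (le_trans vw)//; lra.
have tz : enorm ((t * enorm w) *: z) <= t * enorm w * 2.
  by rewrite enormZ ger0_norm ?mulr_ge0 ?enorm_ge0// ler_wpM2l// mulr_ge0 ?enorm_ge0.
have h1 : root4 (w + (t * enorm w) *: z) <= root4 w * (1 + t / 2).
  by apply: bnd; rewrite (le_trans (enormD_le _ _))// lerD2l.
have h2 : root4 (w - (t * enorm w) *: z) <= root4 w * (1 + t / 2).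
  by apply: bnd; rewrite (le_trans (enormD_le _ _))// lerD2l enormN.
lra.
Qed.

End FourthRootNorm.

(** * Power and kernel integrals *)

Section PowerIntegrals.
Context {R : realType}.
Implicit Types (a b c p t : R).
Local Notation mu := (@lebesgue_measure R).

Lemma powR_continuous_at p t : 0 < t -> {for t, continuous (@powR R ^~ p)}.
Proof.
move=> t0; apply: differentiable_continuous; apply/derivable1_diffP.
by have [] := is_derive1_powR p t0.
Qed.

Lemma powR_within_continuous p a (A : set R) : 0 < a ->
  (forall t, A t -> a <= t) -> {within A, continuous (@powR R ^~ p)}.
Proof.
move=> a0 aA; apply: continuous_in_subspaceT => t /set_mem/aA at_.
by apply: powR_continuous_at; exact: lt_le_trans at_.
Qed.

Lemma measurable_powR_itv p (A : set R) : measurable A ->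
  measurable_fun A (EFin \o (fun t => t `^ p)).
Proof.
move=> mA; apply/measurable_EFinP.
exact: measurable_funS (measurable_realfun.measurable_powR p).
Qed.

Lemma integral_powR_itv p a b : 0 < a -> a < b -> p + 1 != 0 ->
  (\int[mu]_(t in `[a, b]) (t `^ p)%:E =
   ((b `^ (p + 1) - a `^ (p + 1)) / (p + 1))%:E)%E.
Proof.
move=> a0 ab p1.
pose F t := t `^ (p + 1) / (p + 1).
have dF t : 0 < t -> is_derive t 1 F (t `^ p).
  move=> t0; have -> : t `^ p = (p + 1)^-1 *: ((p + 1) * t `^ (p + 1 - 1)).
    by rewrite addrK /GRing.scale/= mulKf.
  rewrite (_ : F = (p + 1)^-1 \*: (@powR R ^~ (p + 1))); last first.
    by apply/funext => z; rewrite /F /GRing.scale/= mulrC.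
  by apply: is_deriveZ; exact: is_derive1_powR.
have cF t : 0 < t -> {for t, continuous F}.
  move=> t0; apply: differentiable_continuous; apply/derivable1_diffP.
  by have [] := dF _ t0.
rewrite (continuous_FTC2 (F := F)) => //.
- by rewrite -EFinB /F mulrBl.
- by apply: (powR_within_continuous a0) => t /=; rewrite in_itv/= => /andP[].
- split.
  + move=> t; rewrite in_itv/= => /andP[at_ _].
    by have [] := dF _ (lt_trans a0 at_).
  + exact/cvg_at_right_filter/cF.
  + exact/cvg_at_left_filter/cF/(lt_trans a0 ab).
- move=> t; rewrite in_itv/= => /andP[at_ _].
  by rewrite derive1E; exact: (@derive_val _ _ _ _ _ _ _ (dF _ (lt_trans a0 at_))).
Qed.

(** Monotone convergence along an exhaustion by compact intervals: a bound uniform in n gives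
    integrability and the estimate together. It serves for the end at 0 as well as for the end at
    [+oo]. *)
Lemma integral_powR_bigcup p (B : R) (a b : R^nat) (S : set R) :
  (forall n, 0 < a n) -> (forall n, a n < b n) ->
  {homo a : m n / (m <= n)%N >-> n <= m} ->
  {homo b : m n / (m <= n)%N >-> m <= n} ->
  S = \bigcup_n `[a n, b n]%classic ->
  (forall n, (\int[mu]_(t in `[a n, b n]) (t `^ p)%:E <= B%:E)%E) ->
  mu.-integrable S (EFin \o (fun t => t `^ p)) /\
  \int[mu]_(t in S) (t `^ p) <= B.
Proof.
move=> a0 ab aN bN SE hB.
have mS : measurable S by rewrite SE; exact: bigcup_measurable.
have SB : (\int[mu]_(t in S) (t `^ p)%:E <= B%:E)%E.
  rewrite SE.
  have cv : (\int[mu]_(t in `[a n, b n]) (t `^ p)%:E)%E @[n --> \oo] -->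
      (\int[mu]_(t in \bigcup_n `[a n, b n]%classic) (t `^ p)%:E)%E.
    apply: ge0_nondecreasing_set_cvg_integral.
    - move=> m n mn; apply/subsetPset => t /=; rewrite !in_itv/= => /andP[h1 h2].
      by rewrite (le_trans (aN _ _ mn) h1) (le_trans h2 (bN _ _ mn)).
    - by move=> n.
    - by move=> n; exact: measurable_powR_itv.
    - by move=> n t _; rewrite lee_fin powR_ge0.
  by apply: (cvge_to_le cv); apply: nearW => n; exact: hB.
have I : mu.-integrable S (EFin \o (fun t => t `^ p)).
  apply/integrableP; split; first exact: measurable_powR_itv.
  under eq_integral do rewrite gee0_abs ?lee_fin ?powR_ge0//.
  by rewrite (le_lt_trans SB)// ltry.
split => //; rewrite -lee_fin fineK//.
exact: integrable_fin_num.
Qed.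

Lemma integral_powR_near0 p c : -1 < p -> 0 < c ->
  mu.-integrable `]0, c] (EFin \o (fun t => t `^ p)) /\
  \int[mu]_(t in `]0, c]) (t `^ p) <= c `^ (p + 1) / (p + 1).
Proof.
move=> p1 c0.
(* The denominator n + 2 makes the intervals nondegenerate already at n = 0. *)
apply: (@integral_powR_bigcup _ _ (fun n => c / n.+2%:R) (fun=> c)) => //.
- by move=> n; rewrite divr_gt0.
- by move=> n; rewrite ltr_pdivrMr// ltr_pMr// ltr1n.
- move=> m n mn; rewrite ler_pM2l// lef_pV2 ?posrE// ler_nat.
  by rewrite !ltnS.
- apply/seteqP; split => t /=.
    rewrite in_itv/= => /andP[t0 tc].
    exists (Num.truncn (c / t)) => //=; rewrite in_itv/= tc andbT.
    rewrite ler_pdivrMr// mulrC -ler_pdivrMr//.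
    have /ltW/le_trans := truncnS_gt (c / t); apply.
    by rewrite ler_nat.
  case=> n _ /=; rewrite !in_itv/= => /andP[h ->]; rewrite andbT.
  by rewrite (lt_le_trans _ h)// divr_gt0.
- move=> n; rewrite integral_powR_itv ?divr_gt0//; last 2 first.
  + by rewrite ltr_pdivrMr// ltr_pMr// ltr1n.
  + by apply: lt0r_neq0; lra.
  rewrite lee_fin ler_pM2r; last by rewrite invr_gt0; lra.
  by rewrite gerBl powR_ge0.
Qed.

Lemma integral_powR_nearoo p c : p < -1 -> 0 < c ->
  mu.-integrable `[c, +oo[ (EFin \o (fun t => t `^ p)) /\
  \int[mu]_(t in `[c, +oo[) (t `^ p) <= c `^ (p + 1) / (- (p + 1)).
Proof.
move=> p1 c0.
have p1N : p + 1 < 0 by lra.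
apply: (@integral_powR_bigcup _ _ (fun=> c) (fun n => c + n.+1%:R)) => //.
- by move=> n; rewrite ltrDl.
- by move=> m n mn; rewrite lerD2l ler_nat ltnS.
- apply/seteqP; split => t /=.
    rewrite in_itv/= andbT => ct.
    exists (Num.truncn (t - c)) => //=; rewrite in_itv/= ct/=.
    by rewrite -lerBlDl ltW// truncnS_gt.
  by case=> n _ /=; rewrite !in_itv/= => /andP[-> _].
- move=> n; rewrite integral_powR_itv//; last 2 first.
  + by rewrite ltrDl.
  + by rewrite lt_eqF.
  rewrite lee_fin invrN mulrN -mulNr ler_nM2r ?invr_lt0//.
  by rewrite lerDr powR_ge0.
Qed.

End PowerIntegrals.

Section KernelIntegrals.
Context {R : realType}.
Variable s : R.
Hypothesis hs : 1 / 2 < s < 1.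
Implicit Types (a b c t rho A B C E : R) (D : R -> R).
Local Notation mu := (@lebesgue_measure R).
Local Notation ker t := (t `^ (1 + 2 * s)).

Let s2 : 1 / 2 < s. Proof. by case/andP: hs. Qed.
Let s1 : s < 1. Proof. by case/andP: hs. Qed.

Lemma div_ker t : 0 < t -> 1 / ker t = t `^ (- (1 + 2 * s)).
Proof. by move=> t0; rewrite powRN div1r. Qed.

Lemma lin_div_ker t : 0 < t -> t / ker t = t `^ (- (2 * s)).
Proof.
move=> t0; rewrite (_ : - (2 * s) = 1 - (1 + 2 * s)); last by ring.
by rewrite [RHS]powRB ?(gt_eqF t0) ?implybT// powRr1 ?ltW.
Qed.

Lemma sqr_div_ker t : 0 < t -> t ^+ 2 / ker t = t `^ (1 - 2 * s).
Proof.
move=> t0; rewrite (_ : 1 - 2 * s = 2%:R - (1 + 2 * s)); last by ring.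
by rewrite [RHS]powRB ?(gt_eqF t0) ?implybT// powR_mulrn ?ltW.
Qed.

(** The integral of min(t^2, 1) t^(-1-2s) over (0, +oo), split at t = 1. The profile min(t^2, 1)
    dominates second differences that are bounded and quadratic near t = 0. *)
Definition ker_mass : R := 1 / (2 - 2 * s) + 1 / (2 * s).

Lemma measurable_div_ker (S : set R) D : measurable S -> measurable_fun S D ->
  measurable_fun S (fun t => D t / ker t).
Proof.
move=> mS mD; apply: measurable_funM => //.
rewrite (_ : (fun t => (ker t)^-1) = (fun t => t `^ (- (1 + 2 * s)))).
  exact: measurable_funS (measurable_powR _).
by apply/funext => t; rewrite powRN.
Qed.

Lemma integral_min_ker :
  mu.-integrable `]0, +oo[ (EFin \o (fun t => Num.min (t ^+ 2) 1 / ker t)) /\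
  \int[mu]_(t in `]0, +oo[) (Num.min (t ^+ 2) 1 / ker t) <= ker_mass.
Proof.
have h0 t : `]0, +oo[%classic t -> 0 <= Num.min (t ^+ 2) 1 / ker t.
  by move=> _; rewrite divr_ge0 ?powR_ge0// le_min sqr_ge0 ler01.
have mf (S : set R) : measurable S ->
    measurable_fun S (EFin \o (fun t => Num.min (t ^+ 2) 1 / ker t)).
  move=> mS; apply/measurable_EFinP; apply: measurable_div_ker => //.
  apply: measurable_minr; last exact: measurable_cst.
  by apply: measurable_funX; exact: measurable_id.
have p1 : -1 < 1 - 2 * s by move: s1 s2; lra.
have [i1 le1] := @integral_powR_near0 R (1 - 2 * s) 1 p1 ltr01.
have p2 : - (1 + 2 * s) < -1 by move: s1 s2; lra.
have [i2 le2] := @integral_powR_nearoo R (- (1 + 2 * s)) 1 p2 ltr01.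
have bnd : (\int[mu]_(t in `]0%R, +oo[) (Num.min (t ^+ 2) 1 / ker t)%:E
    <= ker_mass%:E)%E.
  rewrite (@itv_bndbnd_setU _ _ _ (BRight 1))//; last first.
    by rewrite bnd_simp.
  rewrite ge0_integral_setU//=; last 3 first.
  - by apply: mf; exact: measurableU.
  - by move=> t [] /=; rewrite !in_itv/= => h; rewrite lee_fin h0//= in_itv/= andbT;
      [case/andP: h|move: h; rewrite andbT; exact: lt_trans].
  - apply/disj_setPS => t []/=; rewrite !in_itv/= => /andP[_ h1].
    by rewrite andbT ltNge h1.
  rewrite EFinD; apply: leeD.
    apply: (@le_trans _ _ (\int[mu]_(t in `]0%R, 1%R]) (t `^ (1 - 2 * s))%:E)%E).
      apply: ge0_le_integral => //.
      - by move=> t _; rewrite lee_fin divr_ge0 ?powR_ge0// le_min sqr_ge0 ler01.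
      - exact: mf.
      - exact: measurable_powR_itv.
      move=> t /=; rewrite in_itv/= => /andP[t0 _].
      by rewrite lee_fin -sqr_div_ker// ler_wpM2r ?invr_ge0 ?powR_ge0// ge_min lexx.
    rewrite -[leLHS]fineK; last exact: integrable_fin_num.
    rewrite lee_fin (le_trans le1)// powR1 le_eqVlt; apply/orP; left; apply/eqP.
    by congr (_ / _); ring.
  apply: (@le_trans _ _ (\int[mu]_(t in `[1%R, +oo[) (t `^ (- (1 + 2 * s)))%:E)%E).
    rewrite -integral_itv_obnd_cbnd; last exact: measurable_powR_itv.
    apply: ge0_le_integral => //.
    - by move=> t _; rewrite lee_fin divr_ge0 ?powR_ge0// le_min sqr_ge0 ler01.
    - exact: mf.
    - exact: measurable_powR_itv.
    move=> t /=; rewrite in_itv/= andbT => t1.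
    have t0 : 0 < t by exact: lt_trans t1.
    rewrite lee_fin -div_ker// ler_wpM2r ?invr_ge0 ?powR_ge0//.
    by rewrite ge_min lexx orbT.
  rewrite -[leLHS]fineK; last exact: integrable_fin_num.
  rewrite lee_fin (le_trans le2)// powR1 le_eqVlt; apply/orP; left; apply/eqP.
  by congr (_ / _); ring.
have I : mu.-integrable `]0, +oo[
    (EFin \o (fun t => Num.min (t ^+ 2) 1 / ker t)).
  apply/integrableP; split; first exact: mf.
  apply: (le_lt_trans _ (ltry ker_mass)); apply: (le_trans _ bnd).
  rewrite le_eqVlt; apply/orP; left; apply/eqP; apply: eq_integral.
  by move=> t /set_mem /h0 t0; rewrite /= ger0_norm.
split=> //; rewrite -lee_fin fineK//.
exact: integrable_fin_num.
Qed.

Lemma integrable_div_ker D E : measurable_fun (`]0, +oo[%classic : set R) D ->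
  (forall t, 0 < t -> `|D t| <= E * Num.min (t ^+ 2) 1) ->
  mu.-integrable `]0, +oo[ (EFin \o (fun t => D t / ker t)).
Proof.
move=> mD DE; have [I _] := integral_min_ker.
have := integrableZl _ E I => /(_ (measurable_itv _)).
apply: le_integrable => //; first by apply/measurable_EFinP; exact: measurable_div_ker.
move=> t /=; rewrite in_itv/= andbT => t0.
rewrite lee_fin normrM (ger0_norm (_ : 0 <= (ker t)^-1)) ?invr_ge0 ?powR_ge0//.
rewrite mulrA normrM [X in _ <= _ * X](ger0_norm (_ : 0 <= (ker t)^-1)) ?invr_ge0 ?powR_ge0//.
by rewrite ler_wpM2r ?invr_ge0 ?powR_ge0// (le_trans (DE _ t0))// ler_norm.
Qed.

(** The three zones are those of the doubling argument: touching paraboloids up to [rho], concave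
    gain up to [b], linear growth beyond. The part in [E], common to all, will absorb the penalty
    and the tail where only |u| <= M is available. *)
Lemma integral_ker_bound D rho b A B C E :
  mu.-integrable `]0, +oo[ (EFin \o (fun t => D t / ker t)) ->
  0 < rho -> rho < b -> 0 <= A -> 0 <= C -> 0 <= E ->
  (forall t, 0 < t -> t <= rho ->
     D t <= A * t ^+ 2 + E * Num.min (t ^+ 2) 1) ->
  (forall t, rho < t -> t <= b ->
     D t <= - B * t ^+ 2 + E * Num.min (t ^+ 2) 1) ->
  (forall t, b < t -> D t <= C * t + E * Num.min (t ^+ 2) 1) ->
  \int[mu]_(t in `]0, +oo[) (D t / ker t) <=
    A * (rho `^ (2 - 2 * s) / (2 - 2 * s)) -
    B * ((b `^ (2 - 2 * s) - rho `^ (2 - 2 * s)) / (2 - 2 * s)) +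
    C * (b `^ (1 - 2 * s) / (2 * s - 1)) + E * ker_mass.
Proof.
move=> ID rho0 rhob A0 C0 E0 D1 D2 D3.
have b0 : 0 < b by exact: lt_trans rhob.
have [I hI] := integral_min_ker.
(* Once the common part is removed, each zone is bounded by a single power of t. *)
pose G t := D t / ker t - E * (Num.min (t ^+ 2) 1 / ker t).
have IE : mu.-integrable `]0, +oo[
    (EFin \o (fun t => E * (Num.min (t ^+ 2) 1 / ker t))).
  by have := integrableZl _ E I => /(_ (measurable_itv _)).
have IG : mu.-integrable `]0, +oo[ (EFin \o G).
  by have := integrableB _ ID IE => /(_ (measurable_itv _)).
have GE : \int[mu]_(t in `]0, +oo[) G t = \int[mu]_(t in `]0, +oo[) (D t / ker t)
   - E * \int[mu]_(t in `]0, +oo[) (Num.min (t ^+ 2) 1 / ker t).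
  by rewrite RintegralB// RintegralZl.
suff : \int[mu]_(t in `]0, +oo[) G t <=
    A * (rho `^ (2 - 2 * s) / (2 - 2 * s)) -
    B * ((b `^ (2 - 2 * s) - rho `^ (2 - 2 * s)) / (2 - 2 * s)) +
    C * (b `^ (1 - 2 * s) / (2 * s - 1)).
  rewrite GE => h; rewrite -lerBlDr (le_trans _ h)// lerD2l lerN2.
  exact: ler_wpM2l.
have S1 := @Rintegral_itvB R G (BRight 0) (BInfty _ false) rho IG.
have IG' : mu.-integrable `]rho, +oo[ (EFin \o G).
  apply: integrableS IG => // t /=; rewrite !in_itv/= !andbT; exact: lt_trans.
have S2 := @Rintegral_itvB R G (BRight rho) (BInfty _ false) b IG'.
have GD (k : R) g t : 0 < t -> D t <= k * g + E * Num.min (t ^+ 2) 1 ->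
    G t <= k * (g / ker t).
  move=> t0 Dt; rewrite /G lerBlDr.
  have -> : k * (g / ker t) + E * (Num.min (t ^+ 2) 1 / ker t) =
     (k * g + E * Num.min (t ^+ 2) 1) / ker t by ring.
  by rewrite ler_wpM2r ?invr_ge0 ?powR_ge0.
have p1 : -1 < 1 - 2 * s by move: s1 s2; lra.
have [i1 le1] := @integral_powR_near0 R (1 - 2 * s) rho p1 rho0.
have p2 : - (2 * s) < -1 by move: s1 s2; lra.
have [i2 le2] := @integral_powR_nearoo R (- (2 * s)) b p2 b0.
have ps : 1 - 2 * s + 1 = 2 - 2 * s by ring.
have piece1 : \int[mu]_(t in `]0, rho]) G t <=
    A * (rho `^ (2 - 2 * s) / (2 - 2 * s)).
  apply: (@le_trans _ _ (\int[mu]_(t in `]0, rho]) (A * t `^ (1 - 2 * s)))).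
    apply: le_Rintegral => //.
    - apply: integrableS IG => // t /=; rewrite !in_itv/= => /andP[-> //].
    - by have := integrableZl _ A i1 => /(_ (measurable_itv _)).
    move=> t /=; rewrite in_itv/= => /andP[t0 tr].
    by rewrite -sqr_div_ker//; apply: GD => //; exact: D1.
  by rewrite RintegralZl// ler_wpM2l// (le_trans le1)// ps.
have piece3 : \int[mu]_(t in `]b, +oo[) G t <=
    C * (b `^ (1 - 2 * s) / (2 * s - 1)).
  have i2' : mu.-integrable `]b, +oo[ (EFin \o (fun t => t `^ (- (2 * s)))).
    by apply: integrableS i2 => // t /=; rewrite !in_itv/= !andbT; exact: ltW.
  apply: (@le_trans _ _ (\int[mu]_(t in `]b, +oo[) (C * t `^ (- (2 * s))))).
    apply: le_Rintegral => //.
    - apply: integrableS IG => // t /=; rewrite !in_itv/= !andbT; exact: lt_trans.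
    - by have := integrableZl _ C i2' => /(_ (measurable_itv _)).
    move=> t /=; rewrite in_itv/= andbT => bt.
    have t0 : 0 < t by exact: lt_trans bt.
    by rewrite -lin_div_ker//; apply: GD => //; exact: D3.
  rewrite RintegralZl// ler_wpM2l// Rintegral_itv_obnd_cbnd// (le_trans le2)//.
  by rewrite (_ : - (2 * s) + 1 = 1 - 2 * s) ?opprB//; ring.
have piece2 : \int[mu]_(t in `]rho, b]) G t <=
    - (B * ((b `^ (2 - 2 * s) - rho `^ (2 - 2 * s)) / (2 - 2 * s))).
  have [i3 _] := @integral_powR_near0 R (1 - 2 * s) b p1 b0.
  have i3' : mu.-integrable `]rho, b] (EFin \o (fun t => t `^ (1 - 2 * s))).
    apply: integrableS i3 => // t /=; rewrite !in_itv/= => /andP[+ ->].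
    by rewrite andbT; exact: lt_trans.
  apply: (@le_trans _ _ (\int[mu]_(t in `]rho, b]) (- B * t `^ (1 - 2 * s)))).
    apply: le_Rintegral => //.
    - apply: integrableS IG => // t /=; rewrite !in_itv/= andbT => /andP[+ _].
      exact: lt_trans.
    - by have := integrableZl _ (- B) i3' => /(_ (measurable_itv _)).
    move=> t /=; rewrite in_itv/= => /andP[rt tb].
    have t0 : 0 < t by exact: lt_trans rt.
    by rewrite -sqr_div_ker//; apply: GD => //; exact: D2.
  rewrite RintegralZl// Rintegral_itv_obnd_cbnd// /Rintegral integral_powR_itv//.
    by rewrite ps mulNr.
  by rewrite ps gt_eqF//; move: s1 s2; lra.
have {}S1 : \int[mu]_(t in `]0, +oo[) G t = \int[mu]_(t in `]0, rho]) G t +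
    \int[mu]_(t in `]rho, +oo[) G t.
  by rewrite -S1 ?bnd_simp ?ltW// addrC subrK.
have {}S2 : \int[mu]_(t in `]rho, +oo[) G t = \int[mu]_(t in `]rho, b]) G t +
    \int[mu]_(t in `]b, +oo[) G t.
  by rewrite -S2 ?bnd_simp ?ltW// addrC subrK.
by rewrite S1 S2 addrA; exact: lerD (lerD piece1 piece2) piece3.
Qed.

End KernelIntegrals.

(** * The operator on patched functions *)

Section PatchedDirectional.
Context {R : realType} {N : nat}.
Implicit Types (u : 'rV[R]_N -> R) (x y p q xi : 'rV[R]_N).

Lemma line_continuous x xi : continuous (fun t : R => x + t *: xi).
Proof.
move=> t; apply: (@cvgD _ _ _ (nbhs t)); first exact: cvg_cst.
by apply: (@cvgZ _ _ _ (nbhs t)); [exact: cvg_id|exact: cvg_cst].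
Qed.

Lemma measurable_borel_line u x xi : borel_fun u ->
  measurable_fun [set: R] (fun t : R => u (x + t *: xi)).
Proof.
move=> mu.
have mline : @measurable_fun _ _ R (g_sigma_algebraType (@open 'rV[R]_N)) setT
    (fun t : R => x + t *: xi).
  apply: (@measurability _ _ R (g_sigma_algebraType (@open 'rV[R]_N)) setT
    (fun t : R => x + t *: xi) (@open 'rV[R]_N) erefl).
  move=> _ [B oB <-]; rewrite setTI; apply: open_measurable.
  by have /continuousP := @line_continuous x xi; apply.
exact: (@measurable_comp _ _ _ R (g_sigma_algebraType (@open 'rV[R]_N)) R
  setT u setT
  (fun t : R => x + t *: xi) measurableT (fun _ _ => I) mu mline).
Qed.

Lemma measurable_delta2_line u x xi : borel_fun u ->
  measurable_fun [set: R] (fun t : R => delta2 u x (t *: xi)).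
Proof.
move=> mu; apply: measurable_funB; last exact: measurable_cst.
apply: measurable_funD; first exact: measurable_borel_line.
rewrite (_ : (fun t : R => _) = (fun t : R => u (x + t *: - xi))).
  exact: measurable_borel_line.
by apply/funext => t; rewrite scalerN.
Qed.

Lemma delta2_bound u x y (M : R) : (forall z, `|u z| <= M) ->
  `|delta2 u x y| <= 4 * M.
Proof.
move=> uM; have := uM (x + y); have := uM (x - y); have := uM x.
rewrite /delta2 !ler_norml => /andP[? ?] /andP[? ?] /andP[? ?].
by apply/andP; split; lra.
Qed.

Section Patch.
Variables (s M rho c a b : R) (p q x : 'rV[R]_N) (u : 'rV[R]_N -> R).
Hypothesis hs : 1 / 2 < s < 1.
Hypothesis uM : forall z, `|u z| <= M.
Hypothesis bu : borel_fun u.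
Hypothesis rho01 : 0 < rho <= 1.
Let phi := paraboloid c a p b q.
Hypothesis phix : phi x = u x.
Local Notation psi := (patch u (closure (eball x rho)) phi).
Local Notation mu := (@lebesgue_measure R).

(** As |xi| = 1, both x + t xi and x - t xi lie at distance exactly t from x, so they leave the ball
    together and no mixed case arises. The ball is closed, whence t <= rho. *)
Lemma delta2_patch (t : R) xi : esphere xi -> 0 < t ->
  delta2 psi x (t *: xi) =
  if t <= rho then 2 * (a + b) * t ^+ 2 else delta2 u x (t *: xi).
Proof.
move=> xi1 t0; case/andP: rho01 => r0 _.
have n1 : enorm (x + t *: xi - x) = t.
  by rewrite addrAC subrr add0r enormZ xi1 mulr1 gtr0_norm.
have n2 : enorm (x - t *: xi - x) = t.
  by rewrite addrAC subrr add0r enormN enormZ xi1 mulr1 gtr0_norm.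
have px : psi x = u x.
  rewrite /patch mem_set// closure_eball//= subrr.
  by rewrite enorm0 ltW.
case: ifPn => [tr|]; last rewrite -ltNge => tr.
- have <- : delta2 phi x (t *: xi) = 2 * (a + b) * t ^+ 2.
    by rewrite delta2_paraboloid edotZl edotZr -sqr_enorm xi1 expr1n; ring.
  rewrite /delta2 px -phix /patch !mem_set//= closure_eball//=.
    by rewrite n2.
  by rewrite n1.
- rewrite /delta2 px /patch !memNset//= closure_eball//=.
    by rewrite n2; apply/negP; rewrite -ltNge.
  by rewrite n1; apply/negP; rewrite -ltNge.
Qed.

Lemma integrable_patch xi : esphere xi ->
  mu.-integrable `]0, +oo[
    (EFin \o (fun t => delta2 psi x (t *: xi) / t `^ (1 + 2 * s))).
Proof.
move=> xi1; case/andP: rho01 => r0 r1.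
have M0 : 0 <= M by exact: le_trans (uM 0).
(* The first summand controls the paraboloid for t <= rho, the second the bound 4 M for t > rho,
   where min(t^2, 1) >= rho^2 because rho <= 1. *)
apply: (integrable_div_ker hs (E := 2 * `|a + b| + 4 * M / rho ^+ 2)).
  apply: (eq_measurable_fun (fun t : R =>
    if t <= rho then 2 * (a + b) * t ^+ 2 else delta2 u x (t *: xi))).
    move=> t /set_mem/=; rewrite in_itv/= andbT => t0.
    by rewrite delta2_patch.
  apply: (@measurable_funS _ _ _ _ setT) => //.
  apply: measurable_fun_ifT.
  - apply: measurable_fun_ler; [exact: measurable_id|exact: measurable_cst].
  - apply: measurable_funM; first exact: measurable_cst.
    by apply: measurable_funX; exact: measurable_id.
  - exact: measurable_delta2_line.
move=> t t0; rewrite delta2_patch//.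
have r2 : 0 < rho ^+ 2 by rewrite exprn_gt0.
have h4 : 0 <= 4 * M / rho ^+ 2 by rewrite divr_ge0 ?mulr_ge0// ltW.
case: ifPn => [tr|]; last rewrite -ltNge => tr.
  have t1 : t ^+ 2 <= 1 by rewrite expr_le1// ?(le_trans tr)// ltW.
  rewrite min_l// normrM normrM (ger0_norm (sqr_ge0 t)) ger0_norm//.
  by rewrite ler_wpM2r ?sqr_ge0// lerDl.
rewrite (le_trans (delta2_bound _ _ uM))// [leRHS]mulrDl.
have : 4 * M <= 4 * M / rho ^+ 2 * Num.min (t ^+ 2) 1.
  rewrite mulrAC ler_pdivlMr// ler_wpM2l ?mulr_ge0// le_min.
  rewrite expr_le1 ?(ltW r0)// r1 andbT.
  by rewrite ler_pXn2r// ?nnegrE ltW// (lt_trans r0).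
move=> /le_trans; apply; rewrite lerDr mulr_ge0 ?mulr_ge0//.
by rewrite le_min sqr_ge0 ler01.
Qed.

Lemma I_dir_patch (Cs : R -> R) xi : esphere xi ->
  I_dir Cs s xi psi x = (Cs s *
    \int[mu]_(t in `]0, +oo[) (delta2 psi x (t *: xi) / t `^ (1 + 2 * s)))%:E.
Proof.
move=> xi1; rewrite /I_dir EFinM; congr (_ * _)%E.
by rewrite fineK//; apply: integrable_fin_num => //; exact: integrable_patch.
Qed.

End Patch.

End PatchedDirectional.

(** * Doubling of variables *)

Section Comparison.
Context {R : realType} {T : Type}.

(** The infimum of G and the supremum of H are estimated by their values at [e]; the remaining
    supremum and infimum require all pairs (xi, eta). The supremum over xi is bounded with eta
    fixed, the infimum over eta afterwards, so that extended reals are never subtracted. *)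
Lemma inf_sup_comparison (S : set T) (G H : T -> R) (c B f1 f2 : R) e : 0 < c ->
  S e -> (forall xi eta, S xi -> S eta -> G e - H e + (G xi - H eta) <= B) ->
  (f1%:E <= ereal_inf [set (c * G xi)%:E | xi in S] +
            ereal_sup [set (c * G xi)%:E | xi in S])%E ->
  (ereal_inf [set (c * H xi)%:E | xi in S] +
   ereal_sup [set (c * H xi)%:E | xi in S] <= f2%:E)%E ->
  f1 - f2 <= c * B.
Proof.
move=> c0 Se GH f1le f2ge.
have infG : (ereal_inf [set (c * G xi)%:E | xi in S] <= (c * G e)%:E)%E.
  by apply: ereal_inf_lbound; exists e.
have supH : ((c * H e)%:E <= ereal_sup [set (c * H xi)%:E | xi in S])%E.
  by apply: ereal_sup_ubound; exists e.
have lbH eta : S eta -> f1 - c * B - c * H e <= c * H eta.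
  move=> Seta.
  have supG : (ereal_sup [set (c * G xi)%:E | xi in S] <=
      (c * (B - (G e - H e) + H eta))%:E)%E.
    apply: ge_ereal_sup => _ [xi Sxi <-]; rewrite lee_fin ler_pM2l//.
    by have := GH _ _ Sxi Seta; lra.
  have := le_trans f1le (leeD infG supG).
  by rewrite -EFinD lee_fin; lra.
have infH : ((f1 - c * B - c * H e)%:E <=
    ereal_inf [set (c * H xi)%:E | xi in S])%E.
  by apply: le_ereal_inf_tmp => _ [eta Seta <-]; rewrite lee_fin lbH.
have := le_trans (leeD infH supH) f2ge.
by rewrite -EFinD lee_fin; lra.
Qed.

End Comparison.

(** * Second differences at a maximum point of the doubled function *)

Section MaximumPoint.
Context {R : realType} {N : nat}.
Variables (u : 'rV[R]_N -> R) (M L m : R) (x0 xb yb : 'rV[R]_N).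
Local Notation root4 v := (enorm v `^ 4^-1).
Hypothesis L0 : 0 <= L.
Hypothesis m0 : 0 <= m.
Hypothesis uM : forall z, `|u z| <= M.
Hypothesis umax : forall x y,
  u x - u y - L * root4 (x - y) - m * edot (x - x0) (x - x0) <=
  u xb - u yb - L * root4 (xb - yb) - m * edot (xb - x0) (xb - x0).
Hypothesis xyb : 0 < enorm (xb - yb).
Local Notation w := (xb - yb).
Local Notation a := (enorm (xb - yb)).
Implicit Types (v x y z xi eta zeta : 'rV[R]_N) (t : R).

Lemma delta2N x eta : delta2 u x (- eta) = delta2 u x eta.
Proof. by rewrite /delta2 opprK (addrC (u (x - eta))). Qed.

(** Sum of the maximality inequalities at (xb + t xi, yb + t eta) and (xb - t xi, yb - t eta). By
    the parallelogram identity the penalty contributes exactly 2 m t^2, wherever xb lies. *)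
Lemma delta2_doubling xi eta t : esphere xi ->
  delta2 u xb (t *: xi) - delta2 u yb (t *: eta) <=
  L * (root4 (w + t *: (xi - eta)) + root4 (w - t *: (xi - eta))
       - 2 * root4 w) + 2 * m * t ^+ 2.
Proof.
move=> xi1.
have h1 := umax (xb + t *: xi) (yb + t *: eta).
have h2 := umax (xb - t *: xi) (yb - t *: eta).
have E1 : xb + t *: xi - (yb + t *: eta) = w + t *: (xi - eta).
  by apply/rowP => i; rewrite !mxE; ring.
have E2 : xb - t *: xi - (yb - t *: eta) = w - t *: (xi - eta).
  by apply/rowP => i; rewrite !mxE; ring.
have D : edot (xb + t *: xi - x0) (xb + t *: xi - x0) +
    edot (xb - t *: xi - x0) (xb - t *: xi - x0) =
    2 * edot (xb - x0) (xb - x0) + 2 * t ^+ 2.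
  have xx : edot xi xi = 1 by rewrite -sqr_enorm xi1 expr1n.
  rewrite (addrAC xb (t *: xi)) (addrAC xb (- (t *: xi))) edot_parallelogram.
  by rewrite edotZl edotZr xx; ring.
rewrite E1 in h1; rewrite E2 in h2; rewrite /delta2.
have mD : m * edot (xb + t *: xi - x0) (xb + t *: xi - x0) +
    m * edot (xb - t *: xi - x0) (xb - t *: xi - x0) =
    2 * (m * edot (xb - x0) (xb - x0)) + 2 * m * t ^+ 2.
  by rewrite -mulrDr D; ring.
move: h1 h2 mD; set X1 := root4 _; set X2 := root4 (w - _); set X3 := root4 _.
set Y1 := m * _; set Y2 := m * _; set Y3 := m * _ => h1 h2 mD.
lra.
Qed.

Lemma radial_sphere : esphere (a^-1 *: w).
Proof.
by rewrite /esphere/= enormZ ger0_norm ?invr_ge0 ?enorm_ge0// mulVf// gt_eqF.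
Qed.

(** Second differences are even in the displacement: eta = -e produces the same quantity at yb as
    eta = e, but [w] moves by 2 t e instead of staying fixed. *)
Lemma delta2_radial t :
  delta2 u xb (t *: (a^-1 *: w)) - delta2 u yb (t *: (a^-1 *: w)) <=
  L * (root4 (w + (2 * (t / a)) *: w) + root4 (w - (2 * (t / a)) *: w)
       - 2 * root4 w) + 2 * m * t ^+ 2.
Proof.
have := delta2_doubling (- (a^-1 *: w)) t radial_sphere.
rewrite scalerN delta2N opprK.
suff -> : t *: (a^-1 *: w + a^-1 *: w) = (2 * (t / a)) *: w by [].
by apply/rowP => i; rewrite !mxE; ring.
Qed.

(* Replacing eta by - eta if needed, one may assume that xi and eta form an
   acute angle, and then |xi - eta|^2 <= 2. *)
Lemma delta2_transversal xi eta : esphere xi -> esphere eta ->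
  exists2 zeta, edot zeta zeta <= 2 & forall t,
  delta2 u xb (t *: xi) - delta2 u yb (t *: eta) <=
  L * (root4 (w + ((t / a) * a) *: zeta) + root4 (w - ((t / a) * a) *: zeta)
       - 2 * root4 w) + 2 * m * t ^+ 2.
Proof.
move=> xi1 eta1.
have xx : edot xi xi = 1 by rewrite -sqr_enorm xi1 expr1n.
have ee : edot eta eta = 1 by rewrite -sqr_enorm eta1 expr1n.
have a0 : a != 0 by rewrite gt_eqF.
have [xe|xe] := leP 0 (edot xi eta).
  exists (xi - eta); first by rewrite !edotE (edotC eta xi) xx ee; lra.
  by move=> t; rewrite divfK//; exact: delta2_doubling.
exists (xi - - eta); first by rewrite opprK !edotE (edotC eta xi) xx ee; lra.
move=> t; rewrite divfK//.
have := delta2_doubling (- eta) t xi1.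
by rewrite scalerN delta2N.
Qed.

(** The radial gain 3/4 minus the transversal loss 1/2 leaves the factor 1/4; each bracket adds 2 m
    t^2. *)
Lemma doubling_near xi eta t : esphere xi -> esphere eta ->
  0 <= t -> t <= a / 2 ->
  delta2 u xb (t *: (a^-1 *: w)) - delta2 u yb (t *: (a^-1 *: w)) +
  (delta2 u xb (t *: xi) - delta2 u yb (t *: eta)) <=
  - (L * root4 w / (4 * a ^+ 2)) * t ^+ 2 + 4 * m * t ^+ 2.
Proof.
move=> xi1 eta1 t0 ta.
have sg : 0 <= t / a <= 2^-1.
  by rewrite divr_ge0 ?enorm_ge0//= ler_pdivrMr// mulrC.
have [zeta z2 /(_ t) h2] := delta2_transversal xi1 eta1.
have k1 := ler_wpM2l L0 (root4_radial_concave w sg).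
have k2 := ler_wpM2l L0 (root4_transversal_quadratic (t / a) xyb z2).
have h1 := le_trans (delta2_radial t) (lerD k1 (lexx _)).
have {}h2 := le_trans h2 (lerD k2 (lexx _)).
apply: (le_trans (lerD h1 h2)); rewrite le_eqVlt; apply/orP; left; apply/eqP.
by field; rewrite gt_eqF.
Qed.

(** For t > 1 each of the four second differences is at most 4 M in absolute value, whence 16 M; for
    t <= 1 the radial and transversal linear bounds are added. *)
Lemma doubling_far xi eta t : esphere xi -> esphere eta -> a / 2 <= t ->
  delta2 u xb (t *: (a^-1 *: w)) - delta2 u yb (t *: (a^-1 *: w)) +
  (delta2 u xb (t *: xi) - delta2 u yb (t *: eta)) <=
  2 * L * root4 w / a * t + (4 * m + 16 * M) * Num.min (t ^+ 2) 1.
Proof.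
move=> xi1 eta1 ta.
have t0 : 0 <= t by rewrite (le_trans _ ta)// divr_ge0 ?enorm_ge0.
have M0 : 0 <= M by exact: le_trans (uM 0).
have [t1|t1] := leP (t ^+ 2) 1; last first.
  have h0 : 0 <= 2 * L * root4 w / a * t.
    by rewrite mulr_ge0// divr_ge0 ?enorm_ge0// mulr_ge0 ?powR_ge0// mulr_ge0.
  have bnd z v : delta2 u z v <= 4 * M.
    by have := delta2_bound z v uM; rewrite ler_norml => /andP[].
  have bndN z v : - delta2 u z v <= 4 * M.
    by have := delta2_bound z v uM; rewrite ler_norml lerNl => /andP[].
  apply: (le_trans (lerD (lerD (bnd _ _) (bndN _ _)) (lerD (bnd _ _) (bndN _ _)))).
  move: h0; set Z := 2 * L * _ / _ * _. move: m0 M0. lra.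
have sg : 2^-1 <= t / a by rewrite ler_pdivlMr// mulrC.
have sg0 : 0 <= t / a by rewrite divr_ge0 ?enorm_ge0.
have [zeta z2 /(_ t) h2] := delta2_transversal xi1 eta1.
have k1 := ler_wpM2l L0 (root4_radial_linear w sg).
have k2 := ler_wpM2l L0 (root4_transversal_linear xyb z2 sg0).
have h1 := le_trans (delta2_radial t) (lerD k1 (lexx _)).
have {}h2 := le_trans h2 (lerD k2 (lexx _)).
apply: (le_trans (lerD h1 h2)).
have : 0 <= 16 * M * t ^+ 2 by rewrite mulr_ge0 ?sqr_ge0// mulr_ge0.
rewrite -subr_ge0 => h; rewrite -subr_ge0; apply: (le_trans h).
by rewrite le_eqVlt; apply/orP; left; apply/eqP; field; rewrite gt_eqF.
Qed.

Local Notation kap := (L * root4 w / (8 * a ^+ 2)).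

(** Freezing y = yb in the maximality bounds u by a constant plus L|x - yb|^(1/4) + m|x - x0|^2. The
    root is then replaced by its tangent paraboloid at [w], and the constant gives equality at xb.
    Freezing x = xb gives [test_below]. *)
Definition test_above :=
  paraboloid (u xb - kap * edot w w - m * edot (xb - x0) (xb - x0)) kap yb m x0.

Definition test_below :=
  paraboloid (u yb + kap * edot w w) (- kap) xb 0 xb.

Lemma test_above_eq : test_above xb = u xb.
Proof. by rewrite /test_above /paraboloid; ring. Qed.

Lemma test_below_eq : test_below yb = u yb.
Proof.
rewrite /test_below /paraboloid (_ : edot (yb - xb) (yb - xb) = edot w w).
  by ring.
by rewrite -!sqr_enorm enorm_distC.
Qed.

Lemma root4_tangent v :
  L * root4 v <= L * root4 w + kap * (edot v v - edot w w).
Proof.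
rewrite (le_trans (ler_wpM2l L0 (root4_le_paraboloid v xyb)))//.
by rewrite le_eqVlt; apply/orP; left; apply/eqP; ring.
Qed.

Lemma test_above_ge x : u x <= test_above x.
Proof.
move: (umax x yb) (root4_tangent (x - yb)); rewrite /test_above /paraboloid.
move: (root4 w) (root4 (x - yb)) (edot (x - yb) (x - yb)) (kap) => ? ? ? ?.
by move: (edot (x - x0) _) (edot w w) (edot (xb - x0) _) => ? ? ?; lra.
Qed.

Lemma test_below_le y : test_below y <= u y.
Proof.
have E : edot (y - xb) (y - xb) = edot (xb - y) (xb - y).
  by rewrite -!sqr_enorm enorm_distC.
move: (umax xb y) (root4_tangent (xb - y)); rewrite /test_below /paraboloid E.
move: (root4 w) (root4 (xb - y)) (edot (xb - y) (xb - y)) (kap) => ? ? ? ?.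
by move: (edot w w) (edot (xb - x0) _) => ? ?; lra.
Qed.

End MaximumPoint.

(** * The bound on L at a maximum point *)

Section CoreEstimate.
Context {R : realType} {N : nat}.
Local Notation root4 v := (enorm v `^ 4^-1).
Local Notation mu := (@lebesgue_measure R).

Lemma small_radius (K p r : R) : 0 <= K -> 0 < p -> 0 < r ->
  exists2 rho, 0 < rho < r & K * rho `^ p <= 1.
Proof.
move=> K0 p0 r0.
have /cvgrPdist_lt /(_ (K + 1)^-1) := @powR_cvg0 R p p0.
have K1 : 0 < K + 1 by lra.
rewrite invr_gt0 => /(_ K1) h.
near (0 : R)^'+ => rho.
have rho0 : 0 < rho by near: rho; exact: nbhs_right_gt.
exists rho; first by rewrite rho0/=; near: rho; exact: nbhs_right_lt.
have : `|0 - rho `^ p| < (K + 1)^-1 by near: rho; exact: h.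
rewrite sub0r normrN ger0_norm ?powR_ge0// => hp.
have : (K + 1) * rho `^ p <= 1 by rewrite mulrC -ler_pdivlMr// div1r ltW.
by have := powR_ge0 rho p; nra.
Unshelve. all: by end_near.
Qed.

(** With W = (a/2)^(-2s) the left side equals a^(1/4) W (1/(2s - 1) - 1/(16 (2 - 2s))). For s >
    99/100 the last factor is at most 100/98 - 25/8 < -2, and a^(1/4) W >= a (a/2)^(-1) = 2 because
    a <= 1. This is the origin of the threshold on s. *)
Lemma leading_term (s a : R) : 99 / 100 < s < 1 -> 0 < a <= 1 ->
  - (a `^ 4^-1 / (4 * a ^+ 2)) * ((a / 2) `^ (2 - 2 * s) / (2 - 2 * s)) +
  2 * a `^ 4^-1 / a * ((a / 2) `^ (1 - 2 * s) / (2 * s - 1)) <= - 4.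
Proof.
move=> /andP[s0 s1] /andP[a0 a1].
have b0 : 0 < a / 2 by rewrite divr_gt0.
have bn0 : a / 2 != 0 by rewrite gt_eqF.
pose W := (a / 2) `^ (- (2 * s)).
have -> : (a / 2) `^ (2 - 2 * s) = (a / 2) ^+ 2 * W.
  by rewrite powRD ?bn0 ?implybT// (@powR_mulrn _ _ 2) ?ltW.
have -> : (a / 2) `^ (1 - 2 * s) = (a / 2) * W.
  by rewrite powRD ?bn0 ?implybT// powRr1 ?ltW.
have rW : 2 <= a `^ 4^-1 * W.
  have h1 : a <= a `^ 4^-1 by apply: ger1_powR; rewrite ?a0//; lra.
  have h2 : (a / 2)^-1 <= W.
    have /ger_powR b1 : 0 < a / 2 <= 1 by rewrite b0/=; lra.
    by rewrite -(powR_inv1 (ltW b0)); apply: b1; lra.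
  rewrite -[leLHS](_ : a * (a / 2)^-1 = 2); last by field; rewrite gt_eqF.
  by apply: ler_pM => //; [exact: ltW|rewrite invr_ge0 ltW].
set X := _ + _.
have -> : X = a `^ 4^-1 * W * (- (16 * (2 - 2 * s))^-1 + (2 * s - 1)^-1).
  by rewrite /X; field; rewrite !gt_eqF//=; lra.
have q1 : 25 / 8 <= (16 * (2 - 2 * s))^-1.
  rewrite -[leLHS]invrK lef_pV2 ?posrE ?invf_div; lra.
have q2 : (2 * s - 1)^-1 <= 100 / 98.
  rewrite -[leRHS]invrK lef_pV2 ?posrE ?invf_div; lra.
set Y := - _ + _; have Y2 : Y <= -2 by rewrite /Y; lra.
move: Y2 rW; move: (a `^ _ * W) Y => Z Y Y2 Z2.
have : 0 <= (Z - 2) * (-2 - Y) by rewrite mulr_ge0// subr_ge0.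
lra.
Qed.

Lemma doubling_bound (Cs : R -> R) (s M F L m rho0 : R)
    (Omega : set 'rV[R]_N) (f u : 'rV[R]_N -> R) (x0 xb yb : 'rV[R]_N) :
  99 / 100 < s < 1 -> 0 < Cs s -> visc_sol Cs s Omega f u ->
  0 <= L -> 0 <= m -> (forall z, `|u z| <= M) ->
  (forall x y,
    u x - u y - L * root4 (x - y) - m * edot (x - x0) (x - x0) <=
    u xb - u yb - L * root4 (xb - yb) - m * edot (xb - x0) (xb - x0)) ->
  0 < enorm (xb - yb) <= 1 -> 0 < rho0 ->
  (forall z, enorm (z - xb) <= rho0 -> Omega z) ->
  (forall z, enorm (z - yb) <= rho0 -> Omega z) ->
  `|f xb| <= F -> `|f yb| <= F ->
  4 * L <= 2 * F / Cs s + 1 + (4 * m + 16 * M) * ker_mass s.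
Proof.
move=> hs Cs0 [[[_ bu _] usub] [_ usup]] L0 m0 uM umax /andP[a0 a1] r0 xO yO fx fy.
move: (hs) => /andP[s0 s1].
have hs' : 1 / 2 < s < 1 by rewrite s1 andbT; lra.
set w := xb - yb; set a_ := enorm w.
have a1' : a_ <= 1 by [].
have M0 : 0 <= M by exact: le_trans (uM 0).
have r4 : 0 <= root4 w by exact: powR_ge0.
have Lr : 0 <= L * root4 w by rewrite mulr_ge0.
have a2 : 0 < a_ ^+ 2 by rewrite exprn_gt0.
pose A := L * root4 w / a_ ^+ 2; pose B := L * root4 w / (4 * a_ ^+ 2).
pose C := 2 * L * root4 w / a_; pose E := 4 * m + 16 * M.
have A0 : 0 <= A by rewrite divr_ge0// ltW.
have B0 : 0 <= B by rewrite divr_ge0// mulr_ge0// ltW.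
have C0 : 0 <= C by rewrite divr_ge0 ?enorm_ge0// mulr_ge0// mulr_ge0.
have E0 : 0 <= E by rewrite addr_ge0// mulr_ge0.
have s22 : 0 < 2 - 2 * s by lra.
have K0 : 0 <= (A + B) / (2 - 2 * s) by apply: divr_ge0; [exact: addr_ge0|exact: ltW].
have rm0 : 0 < Num.min rho0 (a_ / 2) by rewrite lt_min r0 divr_gt0.
(* [rho] is chosen after [L] and [a_] are known: the paraboloids on (0, rho] together with the gain
   missing there cost at most 1, which is the [+ 1] of the conclusion. *)
have [rho /andP[rho_gt0]] := small_radius K0 s22 rm0.
rewrite lt_min => /andP[rho_lt rho_a] rhoK.
have rho1 : 0 < rho <= 1 by rewrite rho_gt0/= (le_trans (ltW rho_a))// ler_pdivrMr// mul1r (le_trans a1')// ler1n.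
pose phix := test_above u L m x0 xb yb; pose phiy := test_below u L xb yb.
have phixE : phix xb = u xb by exact: test_above_eq.
have phiyE : phiy yb = u yb by exact: test_below_eq.
pose psix := patch u (closure (eball xb rho)) phix.
pose psiy := patch u (closure (eball yb rho)) phiy.
have Ox : Omega xb by apply: xO; rewrite subrr enorm0 ltW.
have Oy : Omega yb by apply: yO; rewrite subrr enorm0 ltW.
have sub : ((f xb)%:E <= I_op Cs s psix xb)%E.
  apply: usub => //.
  - by rewrite closure_eball// => z /= zr; apply: xO; rewrite (le_trans zr)// ltW.
  - exact: paraboloid_C2.
  - by move=> z _; exact: (test_above_ge L0 umax a0).
have sup : (I_op Cs s psiy yb <= (f yb)%:E)%E.
  apply: usup => //.
  - by rewrite closure_eball// => z /= zr; apply: yO; rewrite (le_trans zr)// ltW.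
  - exact: paraboloid_C2.
  - by move=> z _; exact: (test_below_le L0 umax a0).
pose G xi := \int[mu]_(t in `]0, +oo[) (delta2 psix xb (t *: xi) / t `^ (1 + 2 * s)).
pose H xi := \int[mu]_(t in `]0, +oo[) (delta2 psiy yb (t *: xi) / t `^ (1 + 2 * s)).
have GE : [set I_dir Cs s xi psix xb | xi in esphere] =
    [set (Cs s * G xi)%:E | xi in esphere].
  apply: eq_imagel => xi xi1.
  exact: (I_dir_patch hs' uM bu rho1 phixE Cs xi1).
have HE : [set I_dir Cs s xi psiy yb | xi in esphere] =
    [set (Cs s * H xi)%:E | xi in esphere].
  apply: eq_imagel => xi xi1.
  exact: (I_dir_patch hs' uM bu rho1 phiyE Cs xi1).
rewrite /I_op GE in sub; rewrite /I_op HE in sup.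
have e1 := radial_sphere a0; set e := _ *: _ in e1.
have key xi eta : esphere xi -> esphere eta ->
    G e - H e + (G xi - H eta) <= - (4 * L) + 1 + E * ker_mass s.
  move=> xi1 eta1.
  have iG v : esphere v -> mu.-integrable `]0, +oo[
      (EFin \o (fun t => delta2 psix xb (t *: v) / t `^ (1 + 2 * s))).
    exact: (integrable_patch hs' uM bu rho1 phixE).
  have iH v : esphere v -> mu.-integrable `]0, +oo[
      (EFin \o (fun t => delta2 psiy yb (t *: v) / t `^ (1 + 2 * s))).
    exact: (integrable_patch hs' uM bu rho1 phiyE).
  pose D t := delta2 psix xb (t *: e) - delta2 psiy yb (t *: e) +
    (delta2 psix xb (t *: xi) - delta2 psiy yb (t *: eta)).
  have iB v v' : esphere v -> esphere v' -> mu.-integrable `]0, +oo[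
      (EFin \o (fun t => delta2 psix xb (t *: v) / t `^ (1 + 2 * s) -
                         delta2 psiy yb (t *: v') / t `^ (1 + 2 * s))).
    move=> v1 v1'.
    by have := integrableB _ (iG _ v1) (iH _ v1') => /(_ (measurable_itv _)).
  have DE t : D t / t `^ (1 + 2 * s) =
    (delta2 psix xb (t *: e) / t `^ (1 + 2 * s) -
     delta2 psiy yb (t *: e) / t `^ (1 + 2 * s)) +
    (delta2 psix xb (t *: xi) / t `^ (1 + 2 * s) -
     delta2 psiy yb (t *: eta) / t `^ (1 + 2 * s)).
    by rewrite /D; ring.
  have iD : mu.-integrable `]0, +oo[ (EFin \o (fun t => D t / t `^ (1 + 2 * s))).
    have := integrableD _ (iB _ _ e1 e1) (iB _ _ xi1 eta1) => /(_ (measurable_itv _)).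
    by apply: eq_integrable => // t _ /=; rewrite DE.
  have <- : \int[mu]_(t in `]0, +oo[) (D t / t `^ (1 + 2 * s)) =
      G e - H e + (G xi - H eta).
    under eq_Rintegral do rewrite DE.
    rewrite RintegralD//; [|exact: iB|exact: iB].
    by rewrite RintegralB ?RintegralB//; [exact: iG|exact: iH|exact: iG|exact: iH].
  have dx v t : esphere v -> 0 < t -> delta2 psix xb (t *: v) =
      if t <= rho then 2 * (L * root4 w / (8 * a_ ^+ 2) + m) * t ^+ 2
      else delta2 u xb (t *: v).
    by move=> v1 t0; exact: (delta2_patch rho1 phixE v1 t0).
  have dy v t : esphere v -> 0 < t -> delta2 psiy yb (t *: v) =
      if t <= rho then 2 * (- (L * root4 w / (8 * a_ ^+ 2)) + 0) * t ^+ 2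
      else delta2 u yb (t *: v).
    by move=> v1 t0; exact: (delta2_patch rho1 phiyE v1 t0).
  have D1 t : 0 < t -> t <= rho -> D t <= A * t ^+ 2 + E * Num.min (t ^+ 2) 1.
    move=> t0 tr; rewrite /D !dx// !dy// tr min_l; last first.
      by rewrite expr_le1 ?(ltW t0)// (le_trans tr)//; case/andP: rho1.
    (* Each of the four second differences contributes twice the coefficient of its tangent
       paraboloid, hence the 8; the penalty terms 4 m t^2 go into [E]. *)
    have -> : A = 8 * (L * root4 w / (8 * a_ ^+ 2)).
      by rewrite /A; field; rewrite gt_eqF.
    have : 0 <= 16 * M * t ^+ 2 by rewrite mulr_ge0 ?sqr_ge0// mulr_ge0.
    by rewrite /E; lra.
  have D2 t : rho < t -> t <= a_ / 2 ->
      D t <= - B * t ^+ 2 + E * Num.min (t ^+ 2) 1.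
    move=> rt ta; have t0 : 0 < t by exact: lt_trans rt.
    have tr : (t <= rho) = false by rewrite leNgt rt.
    rewrite /D !dx// !dy// tr min_l; last first.
      rewrite expr_le1 ?(ltW t0)// (le_trans ta)// ler_pdivrMr// mul1r.
      by rewrite (le_trans a1')// ler1n.
    apply: (le_trans (doubling_near L0 umax a0 xi1 eta1 (ltW t0) ta)).
    by rewrite lerD2l ler_wpM2r ?sqr_ge0// /E lerDl mulr_ge0.
  have D3 t : a_ / 2 < t -> D t <= C * t + E * Num.min (t ^+ 2) 1.
    move=> ta; have rt : rho < t by exact: lt_trans ta.
    have t0 : 0 < t by exact: lt_trans rt.
    have tr : (t <= rho) = false by rewrite leNgt rt.
    rewrite /D !dx// !dy// tr.
    exact: (doubling_far L0 m0 uM umax a0 xi1 eta1 (ltW ta)).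
  have := integral_ker_bound hs' iD rho_gt0 rho_a A0 C0 E0 D1 D2 D3.
  move=> /le_trans; apply; rewrite lerD2r.
  have lead : a_ `^ 4^-1 = root4 w by [].
  have := leading_term hs (introT andP (conj a0 a1)).
  rewrite -/w -/a_ lead => /(ler_wpM2l L0) lt.
  set P := rho `^ _ in rhoK *; set Q := (a_ / 2) `^ _ in lt *.
  set V := (a_ / 2) `^ _ in lt *.
  have -> : A * (P / (2 - 2 * s)) - B * ((Q - P) / (2 - 2 * s)) +
      C * (V / (2 * s - 1)) = (A + B) / (2 - 2 * s) * P +
      L * (- (root4 w / (4 * a_ ^+ 2)) * (Q / (2 - 2 * s)) +
           2 * root4 w / a_ * (V / (2 * s - 1))).
    by rewrite /B /C; ring.
  by lra.
have f12 : - (2 * F) <= f xb - f yb.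
  move: fx fy; rewrite !ler_norml => /andP[+ _] /andP[_].
  by move: (f xb) (f yb) => ? ?; lra.
have := le_trans f12 (inf_sup_comparison Cs0 e1 key sub sup).
rewrite -ler_pdivrMl// mulrN -/E (mulrC (2 * F)).
by move: (_ * (2 * F)) (E * _) => ? ?; lra.
Qed.

End CoreEstimate.

(** * From the maximum point to a one-sided estimate at a point *)

Section PointwiseHolder.
Context {R : realType} {N : nat}.
Local Notation root4 v := (enorm v `^ 4^-1).

Lemma root4_continuous : continuous (fun v : 'rV[R]_N => root4 v).
Proof.
have -> : (fun v : 'rV[R]_N => root4 v) = Num.sqrt \o (Num.sqrt \o @enorm R N).
  by apply/funext => v; rewrite powR4_sqrt// enorm_ge0.
move=> v; apply: continuous_comp; last exact: sqrt_continuous.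
by apply: continuous_comp; [exact: enorm_continuous|exact: sqrt_continuous].
Qed.

Lemma doubled_continuous (u : 'rV[R]_N -> R) (L m : R) x0
    (p : 'rV[R]_N * 'rV[R]_N) :
  {for p.1, continuous u} -> {for p.2, continuous u} ->
  {for p, continuous (fun q : 'rV[R]_N * 'rV[R]_N =>
     u q.1 - u q.2 - L * root4 (q.1 - q.2) - m * edot (q.1 - x0) (q.1 - x0))}.
Proof.
move=> c1 c2.
have f1 : fst q @[q --> p] --> p.1 by exact: cvg_fst.
have f2 : snd q @[q --> p] --> p.2 by exact: cvg_snd.
apply: (@cvgB _ _ _ (nbhs p)); [apply: (@cvgB _ _ _ (nbhs p));
  [apply: (@cvgB _ _ _ (nbhs p))|]|].
- exact: (cvg_comp _ _ f1 c1).
- exact: (cvg_comp _ _ f2 c2).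
- apply: (@cvgM _ _ (nbhs p)); first exact: cvg_cst.
  have f12 : q.1 - q.2 @[q --> p] --> p.1 - p.2.
    exact: (@cvgB _ _ _ (nbhs p)).
  exact: (cvg_comp _ _ f12 (@root4_continuous (p.1 - p.2))).
- apply: (@cvgM _ _ (nbhs p)); first exact: cvg_cst.
  exact: (cvg_comp _ _ f1 (@edotB_continuous _ _ x0 p.1)).
Qed.

(** A pair violating the estimate makes the doubled function positive at (x0, y), where the penalty
    vanishes. Its maximum over [K] is then positive, and global since positive values occur only in
    [K]; [doubling_bound] contradicts the size of L. *)
Lemma holder_at_point (Cs : R -> R) (s M F L r : R)
    (Omega : set 'rV[R]_N) (f u : 'rV[R]_N -> R) (x0 : 'rV[R]_N) :
  99 / 100 < s < 1 -> 0 < Cs s -> visc_sol Cs s Omega f u -> open Omega ->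
  0 < r <= 1 -> (forall z, enorm (z - x0) <= r -> Omega z /\ `|f z| <= F) ->
  (forall z, `|u z| <= M) ->
  2 * M / (r / 4) `^ 4^-1 <= L ->
  2 * F / Cs s + 1 + (4 * (32 * M / r ^+ 2) + 16 * M) * ker_mass s < 4 * L ->
  forall y, u x0 - u y <= L * root4 (x0 - y).
Proof.
move=> hs Cs0 uf oO /andP[r0 r1] rO uM LM LF y1.
rewrite leNgt; apply/negP => uy1.
(* Chosen so that m (r/4)^2 = 2 M bounds u x - u y: a positive value of the doubled function forces
   |x - x0| <= r/4. The first lower bound on [L] does the same for |x - y|. *)
pose m := 32 * M / r ^+ 2.
have M0 : 0 <= M by exact: le_trans (uM 0).
have r20 : 0 < r ^+ 2 by rewrite exprn_gt0.
have m0 : 0 <= m by rewrite divr_ge0 ?mulr_ge0// ltW.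
have r4 : 0 < r / 4 by rewrite divr_gt0.
have rp : 0 < (r / 4) `^ 4^-1 by rewrite powR_gt0.
have L0 : 0 <= L by rewrite (le_trans _ LM)// divr_ge0 ?mulr_ge0 ?powR_ge0.
pose Phi (q : 'rV[R]_N * 'rV[R]_N) :=
  u q.1 - u q.2 - L * root4 (q.1 - q.2) - m * edot (q.1 - x0) (q.1 - x0).
have u2 x y : u x - u y <= 2 * M.
  have := uM x; have := uM y; rewrite !ler_norml => /andP[? ?] /andP[? ?].
  by lra.
have Phi_gt0 x y : 0 < Phi (x, y) ->
    enorm (x - x0) <= r / 4 /\ enorm (x - y) <= r / 4.
  rewrite /Phi/= => P0; split; rewrite leNgt; apply/negP => h.
  - have : 2 * M <= m * edot (x - x0) (x - x0).
      have -> : 2 * M = m * (r / 4) ^+ 2 by rewrite /m; field; rewrite gt_eqF.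
      rewrite ler_wpM2l// -sqr_enorm ler_pXn2r ?nnegrE ?enorm_ge0//; exact: ltW.
    have : 0 <= L * root4 (x - y) by rewrite mulr_ge0 ?powR_ge0.
    move: P0 (u2 x y); move: (L * _) (m * _) => X Y *; lra.
  - have : 2 * M <= L * root4 (x - y).
      move: LM; rewrite ler_pdivrMr// => /le_trans; apply.
      rewrite ler_wpM2l// ge0_ler_powR// ?nnegrE ?enorm_ge0 ?ltW//.
    have : 0 <= m * edot (x - x0) (x - x0) by rewrite mulr_ge0 ?edot_ge0.
    move: P0 (u2 x y); move: (L * _) (m * _) => X Y *; lra.
pose K := [set x | enorm (x - x0) <= r / 4] `*` [set y | enorm (y - x0) <= r / 2].
have Phi_K q : 0 < Phi q -> K q.
  case: q => x y /Phi_gt0[h1 h2]; split => //=.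
  rewrite (le_trans (enormB_le _ x _))// enorm_distC.
  by rewrite (le_trans (lerD h2 h1))//; lra.
have Phi1 : 0 < Phi (x0, y1).
  by rewrite /Phi/= subrr -sqr_enorm enorm0 expr0n mulr0 subr0 subr_gt0.
have cK : compact K by apply: compact_setX; exact: compact_le_enorm.
have uc x : Omega x -> {for x, continuous u}.
  case: uf => [[[_ _ cu] _] _] Ox.
  by move: cu; rewrite continuous_open_subspace// => /(_ x); apply; rewrite inE.
have cPhi : {within K, continuous Phi}.
  apply: continuous_in_subspaceT => -[x y] /set_mem[/= xK yK].
  by apply: doubled_continuous; apply: uc; [have [] := rO x|have [] := rO y] => //;
    lra.
have [[xb yb] /set_mem Kb bmax] := compact_EVT_max (ex_intro _ _ (Phi_K _ Phi1)) cK cPhi.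
have Phib : 0 < Phi (xb, yb).
  by apply: (lt_le_trans Phi1); apply: bmax; apply/mem_set; exact: Phi_K.
have umax x y : Phi (x, y) <= Phi (xb, yb).
  have [/Phi_K h|h] := ltP 0 (Phi (x, y)); first by apply: bmax; exact/mem_set.
  exact: le_trans (ltW Phib).
have [xb4 ab4] := Phi_gt0 _ _ Phib.
(* On the diagonal the doubled function reduces to minus the penalty. *)
have a0 : 0 < enorm (xb - yb).
  rewrite lt_neqAle enorm_ge0 andbT eq_sym; apply/negP => /eqP /enorm_eq0 xy.
  move: Phib; rewrite /Phi/= xy enorm0 powR0 ?invr_eq0// mulr0 subr0.
  have -> : xb = yb by apply/eqP; rewrite -subr_eq0 xy.
  rewrite subrr sub0r oppr_gt0 ltNge => /negP; apply.
  by rewrite mulr_ge0 ?edot_ge0.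
have a1 : enorm (xb - yb) <= 1 by rewrite (le_trans ab4)//; lra.
have yb2 : enorm (yb - x0) <= r / 2 by case: Kb.
have near_x z : enorm (z - xb) <= r / 2 -> enorm (z - x0) <= r.
  by move=> h; rewrite (le_trans (enormB_le _ xb _))// (le_trans (lerD h xb4))//; lra.
have near_y z : enorm (z - yb) <= r / 2 -> enorm (z - x0) <= r.
  by move=> h; rewrite (le_trans (enormB_le _ yb _))// (le_trans (lerD h yb2))//; lra.
have r2 : 0 < r / 2 by rewrite divr_gt0.
have xbr : enorm (xb - x0) <= r by rewrite (le_trans xb4)//; lra.
have ybr : enorm (yb - x0) <= r by rewrite (le_trans yb2)//; lra.
have := @doubling_bound R N Cs s M F L m (r / 2) Omega f u x0 xb yb hs Cs0 uf L0 m0 uM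
  umax (introT andP (conj a0 a1)) r2
  (fun z h => proj1 (rO z (near_x z h))) (fun z h => proj1 (rO z (near_y z h)))
  (proj2 (rO _ xbr)) (proj2 (rO _ ybr)).
by rewrite leNgt LF.
Qed.

End PointwiseHolder.

(** * Interior estimate *)

Section CompactNeighborhoods.
Context {R : realType} {N : nat}.
Implicit Types (x y z : 'rV[R]_N) (A B K O : set 'rV[R]_N).

Lemma nbhs_eball_subset A x : nbhs x A ->
  exists2 r, 0 < r & [set y | enorm (y - x) <= r] `<=` A.
Proof.
rewrite nbhsE => -[B [oB Bx] BA].
have [r r0 rB] := open_eball_subset oB Bx.
by exists r => //; exact: subset_trans BA.
Qed.

Lemma nbhs_eball x (r : R) : 0 < r -> nbhs x (eball x r).
Proof.
move=> r0; apply: open_nbhs_nbhs; split; first exact: open_eball.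
by rewrite /eball/= subrr enorm0.
Qed.

(** One index n governs both the radius 1/(n + 1) and the bound n, so a single covering argument
    gives both uniformly. Taking f = 0 leaves the radius alone, as in [edist_gt0]. *)
Lemma compact_uniform_eball K O (f : 'rV[R]_N -> R) :
  compact K -> open O -> K `<=` O -> {within O, continuous f} ->
  exists r F : R, 0 < r <= 1 /\
    forall x z, K x -> enorm (z - x) <= r -> O z /\ `|f z| <= F.
Proof.
move=> cK oO KO; rewrite continuous_open_subspace// => cf.
pose P (n : nat) x :=
  forall z, enorm (z - x) <= n.+1%:R^-1 -> O z /\ `|f z| <= n%:R.
have : near_covering K by exact/compact_near_coveringP.
move=> /(_ nat \oo P _).
have h x : K x -> \forall x' \near x & n \near \oo, P n x'.
  move=> Kx; have Ox := KO _ Kx.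
  have fx : nbhs x (fun z => `|f x - f z| < 1).
    have cfx : {for x, continuous f} by apply: cf; rewrite inE.
    have /cvgrPdist_lt /(_ 1 ltr01) := cfx; exact.
  have [r r0 rA] := nbhs_eball_subset
    (filterI (open_nbhs_nbhs (conj oO Ox)) fx).
  have r2 : 0 < r / 2 by rewrite divr_gt0.
  near=> x' n; move=> z zx'.
  have x'x : enorm (x' - x) < r / 2.
    by near: x'; exact: (nbhs_eball x r2).
  have nr : n.+1%:R^-1 < r / 2 by near: n; exact: near_infty_natSinv_lt (PosNum r2).
  have [Oz fz] : O z /\ `|f x - f z| < 1.
    apply: rA => /=; rewrite (le_trans (enormB_le _ x' _))//.
    by rewrite (le_trans (lerD zx' (ltW x'x)))// [leRHS]splitr lerD2r ltW.
  split=> //.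
  have nf : `|f x| + 1 <= n%:R by near: n; exact: nbhs_infty_ger.
  rewrite (le_trans _ nf)// -(subrK (f x) (f z)).
  rewrite (le_trans (ler_normD _ _))// addrC lerD2l distrC.
  exact: ltW.
move=> /(_ h) [n _ /(_ n (leqnn n)) nP].
exists n.+1%:R^-1, n%:R; split.
  by rewrite invr_gt0 ltr0n/= invf_le1// ler1n.
by move=> x z Kx; exact: nP.
Unshelve. all: by end_near.
Qed.

Lemma edist_gt0 A B : open B -> compactly_in A B ->
  (0 < edist A (boundary B))%E.
Proof.
move=> oB [cA AB].
have [|r [F [/andP[r0 _] rB]]] := @compact_uniform_eball _ _ (fun=> 0) cA oB AB.
  by apply: continuous_subspaceT => x; exact: (@cvg_cst _ _ _ (nbhs x)).
apply: (@lt_le_trans _ _ r%:E); first by rewrite lte_fin.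
apply: le_ereal_inf_tmp => _ [x [y [Ax [_ +] ->]]].
rewrite (interior_id _).1// => By; rewrite lee_fin leNgt; apply/negP => xy.
apply: By; have [|//] := rB x y (subset_closure Ax).
by rewrite enorm_distC ltW.
Qed.

(** [edist] sees only the boundary, so connectedness is essential: a segment starting at x and
    leaving B would meet [boundary B] within distance r of x. *)
Lemma eball_subset_of_edist A B x (r : R) : open B -> A `<=` B -> A x ->
  (r%:E < edist A (boundary B))%E ->
  forall z, enorm (z - x) <= r -> B z.
Proof.
move=> oB AB Ax rd z zx.
pose g (t : R) := x + t *: (z - x).
pose S := g @` `[0, 1]%classic.
have cS : connected S.
  apply: connected_continuous_connected; first exact: segment_connected.
  by apply: continuous_subspaceT => t; exact: line_continuous.
have SB : S `&` B = S.
  apply: cS.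
  - exists x; split; last exact: AB.
    by exists 0; rewrite /= ?in_itv/= ?lexx ?ler01// /g scale0r addr0.
  - by exists B.
  - exists (closure B); first exact: closed_closure.
    apply/seteqP; split => y [Sy By]; split => //; first exact: subset_closure.
    apply: contrapT => nBy; case: Sy nBy By => t; rewrite /= in_itv/= => /andP[t0 t1] <- nB cB.
    have : (edist A (boundary B) <= (enorm (x - g t))%:E)%E.
      apply: ereal_inf_lbound; exists x, (g t); split => //; split => //.
      by rewrite (interior_id _).1.
    rewrite leNgt => /negP; apply; apply: le_lt_trans rd; rewrite lee_fin.
    rewrite enorm_distC /g addrAC subrr add0r enormZ ger0_norm//.
    by rewrite (le_trans _ zx)// ler_piMl// enorm_ge0.
have : S z by exists 1; rewrite /= ?in_itv/= ?lexx ?ler01// /g scale1r addrC subrK.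
by rewrite -SB => -[].
Qed.

Lemma sup_norm_le A (u : 'rV[R]_N -> R) (M : R) : 0 <= M ->
  (forall x, A x -> `|u x| <= M) -> (sup_norm A u <= M%:E)%E.
Proof.
move=> M0 uM; rewrite /sup_norm ge_max lee_fin M0/=.
by apply: ge_ereal_sup => _ [x Ax ->]; rewrite lee_fin uM.
Qed.

(** The a priori bound [M] excludes the value [+oo], on which [fine] returns 0. *)
Lemma sup_norm_fine A (u : 'rV[R]_N -> R) (M : R) : 0 <= M ->
  (forall x, A x -> `|u x| <= M) ->
  0 <= fine (sup_norm A u) /\ forall x, A x -> `|u x| <= fine (sup_norm A u).
Proof.
move=> M0 uM; have h := sup_norm_le M0 uM.
have h0 : (0 <= sup_norm A u)%E by rewrite /sup_norm le_max lexx.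
split; first exact: fine_ge0.
move=> x Ax; rewrite -lee_fin fineK; last first.
  by rewrite ge0_fin_numE// (le_lt_trans h)// ltry.
by rewrite /sup_norm le_max; apply/orP; right; apply: ereal_sup_ubound; exists x.
Qed.

End CompactNeighborhoods.

(** * Hölder norm with an explicit constant *)

Section InteriorEstimate.
Context {R : realType} {N : nat}.
Local Notation root4 v := (enorm v `^ 4^-1).

(** The first summand confines the maximum points, the others dominate the bound of
    [doubling_bound]; 2 replaces its 1 to make the comparison strict. *)
Definition holder_const (c s r M F : R) : R :=
  2 * M / (r / 4) `^ 4^-1 +
  (2 * F / c + 2 + (4 * (32 * M / r ^+ 2) + 16 * M) * ker_mass s).

Lemma holder_norm_le (Cs : R -> R) (s M F r : R)
    (Omega w : set 'rV[R]_N) (f u : 'rV[R]_N -> R) :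
  99 / 100 < s < 1 -> 0 < Cs s -> visc_sol Cs s Omega f u -> open Omega ->
  0 < r <= 1 -> 0 <= F ->
  (forall x z, w x -> enorm (z - x) <= r -> Omega z /\ `|f z| <= F) ->
  (forall z, `|u z| <= M) ->
  (holder_norm 4^-1 w u <= (M + holder_const (Cs s) s r M F)%:E)%E.
Proof.
move=> hs Cs0 uf oO hr F0 wO uM.
have M0 : 0 <= M by exact: le_trans (uM 0).
move: (hs) (hr) => /andP[s0 s1] /andP[r0 r1].
set L := holder_const _ _ _ _ _.
have p1 : 0 <= 2 * M / (r / 4) `^ 4^-1.
  by rewrite divr_ge0 ?mulr_ge0 ?powR_ge0.
have p2 : 0 <= 2 * F / Cs s by rewrite divr_ge0 ?mulr_ge0// ltW.
have p3 : 0 <= (4 * (32 * M / r ^+ 2) + 16 * M) * ker_mass s.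
  rewrite mulr_ge0//.
    by rewrite addr_ge0 ?mulr_ge0// invr_ge0 sqr_ge0.
  by rewrite /ker_mass addr_ge0// divr_ge0//; lra.
have LM : 2 * M / (r / 4) `^ 4^-1 <= L.
  by rewrite /L /holder_const lerDl; lra.
have LF : 2 * F / Cs s + 1 + (4 * (32 * M / r ^+ 2) + 16 * M) * ker_mass s < 4 * L.
  by rewrite /L /holder_const; lra.
have L0 : 0 <= L by exact: le_trans LM.
have uL x y : w x -> u x - u y <= L * root4 (x - y).
  by move=> wx; exact: (holder_at_point hs Cs0 uf oO hr (fun z => wO x z wx) uM LM LF).
rewrite /holder_norm EFinD; apply: leeD; first by apply: sup_norm_le.
rewrite /holder_seminorm ge_max lee_fin L0/=.
apply: ge_ereal_sup => _ [x [y [wx wy xy ->]]]; rewrite lee_fin.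
have xy0 : 0 < root4 (x - y).
  rewrite powR_gt0// lt_neqAle enorm_ge0 andbT eq_sym; apply/eqP => /enorm_eq0.
  by move=> /eqP; rewrite subr_eq0 => /eqP.
rewrite ler_pdivrMr// ler_norml uL// andbT lerNl opprB enorm_distC.
exact: uL.
Qed.

End InteriorEstimate.

Theorem theorem1p1 (R : realType) (N : nat) (hN : (1 <= N)%N)
    (Cs : R -> R) (hCs : normalizing N Cs) :
  exists2 s0 : R, 1 / 2 < s0 < 1 &
  forall s : R, s0 < s < 1 ->
  exists2 alpha : R, 0 < alpha < 1 &
  exists2 K : \bar R -> \bar R -> \bar R -> R,
    (forall d M F, 0 < K d M F) &
  forall (Omega : set 'rV[R]_N) (f u : 'rV[R]_N -> R),
    domain Omega ->
    {within Omega, continuous f} ->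
    visc_sol Cs s Omega f u ->
    holder_loc alpha Omega u /\
    (forall w w' : set 'rV[R]_N, open w -> open w' ->
       compactly_in w w' -> compactly_in w' Omega ->
       (holder_norm alpha w u <=
        (K (edist w (boundary w')) (sup_norm setT u) (sup_norm w' f))%:E)%E).
Proof.
exists (99 / 100); first by apply/andP; split; lra.
move=> s hs; exists 4^-1; first by apply/andP; split; lra.
have Cs0 : 0 < Cs s.
  by apply: hCs.1; case/andP: hs => ? ->; rewrite andbT; lra.
(* For d > 0 this radius is at most 1 and strictly below d. The last branch covers [+oo], the value
   of [edist] when one of the sets is empty. *)
pose rad (d : \bar R) : R := if d is d'%:E then Num.min d' 1 / 2 else 1 / 2.
(* The absolute value and the [+ 1] give positivity for all arguments, including those that are not
   distances or norms. *)
exists (fun d M F => `|fine M + holder_const (Cs s) s (rad d) (fine M) (fine F)| + 1).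
  by move=> d M F; rewrite ltr_wpDl.
move=> Omega f u [_ oO _] cf uf.
have [M0 [M0_ge0 uM0]] : exists M0 : R, 0 <= M0 /\ forall z, setT z -> `|u z| <= M0.
  case: (uf) => [[[[B [_ uB]] _ _] _] _].
  exists (`|B| + 1); split=> [|z _]; first by rewrite addr_ge0.
  by apply: uB => //; rewrite (le_lt_trans (ler_norm B))// ltrDl.
have [M_ge0 uM] := sup_norm_fine M0_ge0 uM0.
split.
  move=> w ow [cw wO].
  have [r [F [hr rF]]] := compact_uniform_eball cw oO wO cf.
  apply: (le_lt_trans (@holder_norm_le _ _ Cs s M0 `|F| r Omega w f u
    hs Cs0 uf oO hr (normr_ge0 _) _ (fun z => uM0 z I))); last exact: ltry.
  move=> x z wx zx; have [Oz fz] := rF x z (subset_closure wx) zx.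
  by split => //; rewrite (le_trans fz)// ler_norm.
move=> w w' ow ow' cww' [cw' w'O].
have [r0 [F0 [/andP[r00 _] rF0]]] := compact_uniform_eball cw' oO w'O cf.
have [F_ge0 fF] : 0 <= fine (sup_norm w' f) /\
    forall x, w' x -> `|f x| <= fine (sup_norm w' f).
  apply: (@sup_norm_fine _ _ _ _ `|F0|) => // x w'x.
  have [|_ fx] := rF0 x x (subset_closure w'x); first by rewrite subrr enorm0 ltW.
  by rewrite (le_trans fx)// ler_norm.
have d0 := edist_gt0 ow' cww'.
have ww' : w `<=` w'.
  by case: cww' => _ h; apply: subset_trans h; exact: subset_closure.
set d := edist _ _ in d0 *.
have hrad : 0 < rad d <= 1 /\ ((rad d)%:E < d)%E.
  rewrite /rad; case: d d0 => [d'| |]//=.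
    rewrite !lte_fin => d0.
    have m0 : 0 < Num.min d' 1 by rewrite lt_min d0 ltr01.
    have : Num.min d' 1 <= d' by rewrite ge_min lexx.
    have : Num.min d' 1 <= 1 by rewrite ge_min lexx orbT.
    by move: (Num.min d' 1) m0 => e *; split; [apply/andP; split|]; lra.
  by move=> _; rewrite ltry; split => //; apply/andP; split; lra.
have [hr rd] := hrad.
apply: (le_trans (@holder_norm_le _ _ Cs s (fine (sup_norm setT u))
  (fine (sup_norm w' f)) (rad d) Omega w f u hs Cs0 uf oO hr F_ge0 _
  (fun z => uM z I))).
  move=> x z wx zx.
  have w'z := eball_subset_of_edist ow' ww' wx rd zx.
  by split; [exact/w'O/subset_closure|exact: fF].
by rewrite lee_fin (le_trans (ler_norm _))// lerDl.
Qed.
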